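(* Let $K$ be a field of characteristic different from $2$. (i) Every finitely generated graded bicommutative superalgebra $A$ over $K$ has a rational Hilbert series of the form $$H(A,t)=f(t)\prod_i\frac{1}{1-t^{d_i}},\qquad f(t)\in\mathbb Z[t],$$ where the product is finite and the $d_i$ are positive integers. (ii) If a finitely generated bicommutative superalgebra $A$ over $K$ is $\mathbb N_0^p\times\mathbb N_0^q$-graded, where $\mathbb N_0^p$ and $\mathbb N_0^q$ count the even and odd gradings, respectively, then the Hilbert series of $A$ is of the form $$H(A,U_p,V_q)=f(U_p,V_q)\prod_i\frac{1}{1-U_p^{d_i}},$$ where $f(U_p,V_q)$ is a polynomial with integer coefficients, the product is finite, $d_i=(d_{1i},\dots,d_{pi})\in\mathbb N_0^p\setminus\{0\}$ and $U_p^{d_i}=u_1^{d_{1i}}\cdots u_p^{d_{pi}}$. If $A$ is generated by generators $a_1,\dots,a_r$ of multidegree $(m_{i1},\dots,m_{ip},n_{i1},\dots,n_{iq})$, $i=1,\dots,r$, then the polynomial $f(U_p,V_q)$ satisfies $$\deg_{v_j}f(U_p,V_q)\le2\sum_{i=1}^rn_{ij},\qquad j=1,\dots,q.$$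
   Context: Algebras are not assumed associative or unital. A superalgebra is an algebra $A=A_0\oplus A_1$ with $A_iA_j\subseteq A_{i+j\,(\mathrm{mod}\,2)}$; for $a\in A_i$ write $\overline a=i$. A superalgebra is bicommutative if for all homogeneous elements $x_1(x_2x_3)=(-1)^{\overline{x_1}\,\overline{x_2}}x_2(x_1x_3)$ and $(x_1x_2)x_3=(-1)^{\overline{x_2}\,\overline{x_3}}(x_1x_3)x_2$. In (i), graded means $A=\bigoplus_{n\ge1}A^{(n)}$ with $A^{(m)}A^{(n)}\subseteq A^{(m+n)}$ and each $A^{(n)}$ a $\mathbb Z_2$-graded subspace, so that $A$ has a finite generating set of elements homogeneous with respect to both degree and parity; $H(A,t)=\sum_{n\ge1}\dim(A^{(n)})t^n$. In (ii), $A=\bigoplus A^{(\mathbf m,\mathbf n)}$, $\mathbf m\in\mathbb N_0^p$, $\mathbf n\in\mathbb N_0^q$, is graded compatibly with the multiplication and the $\mathbb Z_2$-grading, and its generators are homogeneous in multidegree and parity. That $\mathbb N_0^p$ and $\mathbb N_0^q$ count the even and odd gradings means that each even generator has multidegree $(\mathbf m,0)$ with $\mathbf m\ne0$, and each odd generator has multidegree $(\mathbf m,\mathbf n)$ with $\mathbf n\neq0$. The Hilbert series is $H(A,U_p,V_q)=\sum\dim(A^{(\mathbf m,\mathbf n)})u_1^{m_1}\cdots u_p^{m_p}v_1^{n_1}\cdots v_q^{n_q}$. *)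

(* Defs.v *)
From mathcomp Require Import all_boot all_order all_algebra.
From mathcomp Require Import sesquilinear.
From mathcomp Require Import mpoly.

Set Implicit Arguments.
Unset Strict Implicit.
Unset Printing Implicit Defensive.

Import GRing.Theory.
Local Open Scope ring_scope.

(* Subspaces are Prop-valued predicates, since the algebras are in general
   infinite-dimensional. *)

Section LinearAlgebra.
Variables (K : fieldType) (E : lmodType K).
Implicit Type V : E -> Prop.

Definition subspace V :=
  V 0 /\ forall (c : K) (x y : E), V x -> V y -> V (c *: x + y).

Definition direct_sum_decomposition (I : eqType) (V : I -> E -> Prop) :=
  [/\ forall i, subspace (V i),
      forall x : E, exists (s : seq I) (y : I -> E),
        (forall i, V i (y i)) /\ x = \sum_(i <- s) y i
    & forall (s : seq I) (y : I -> E), uniq s -> (forall i, V i (y i)) ->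
        \sum_(i <- s) y i = 0 -> forall i, i \in s -> y i = 0].

Definition has_dim V (n : nat) :=
  exists b : 'I_n -> E,
    [/\ forall i, V (b i),
        forall c : 'I_n -> K, \sum_i c i *: b i = 0 -> forall i, c i = 0
      & forall x, V x -> exists c : 'I_n -> K, x = \sum_i c i *: b i].

(* The coefficients of a Hilbert series; in particular every component is
   finite-dimensional. *)
Definition hilbert_function (I : Type) (V : I -> E -> Prop) (H : I -> nat) :=
  forall i, has_dim (V i) (H i).

End LinearAlgebra.

(* Z/2 is represented by bool, with false for the even part, true for the odd
   part, and addition addb, written (+). *)
Record superalgebra (K : fieldType) := Superalgebra {
  carrier :> lmodType K;
  smul : {bilinear carrier -> carrier -> carrier};
  part : bool -> carrier -> Prop;
  part_direct_sum : direct_sum_decomposition part;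
  part_smul : forall (i j : bool) (x y : carrier),
    part i x -> part j y -> part (i (+) j) (smul x y)
}.

Section Superalgebras.
Variables (K : fieldType) (A : superalgebra K).
Local Notation "x ** y" := (smul A x y) (at level 40, left associativity).

Definition bicommutative :=
  forall (i j k : bool) (x y z : A), part i x -> part j y -> part k z ->
    x ** (y ** z) = (-1) ^+ (i && j) *: (y ** (x ** z)) /\
    (x ** y) ** z = (-1) ^+ (j && k) *: ((x ** z) ** y).

Definition generates (r : nat) (a : 'I_r -> A) :=
  forall B : A -> Prop,
    subspace B -> (forall x y, B x -> B y -> B (x ** y)) ->
    (forall i, B (a i)) -> forall x, B x.

Definition finitely_generated := exists (r : nat) (a : 'I_r -> A), generates a.

Definition super_subspace (V : A -> Prop) :=
  subspace V /\
  forall x, V x -> exists x0 x1 : A,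
    [/\ part false x0, part true x1, V x0, V x1 & x = x0 + x1].

Definition graded_by (I : eqType) (add : I -> I -> I) (V : I -> A -> Prop) :=
  [/\ direct_sum_decomposition V,
      forall i, super_subspace (V i)
    & forall i j x y, V i x -> V j y -> V (add i j) (x ** y)].

(* A grading by the positive integers is one by nat with zero component of
   degree 0. *)
Definition positively_graded (V : nat -> A -> Prop) :=
  graded_by addn V /\ forall x, V 0%N x -> x = 0.

(* N^p x N^q is encoded as 'X_{1..p + q}: the coordinates lshift q i count the
   even gradings (variables u) and the coordinates rshift p j the odd ones
   (variables v). *)
Definition multigraded (p q : nat) (V : 'X_{1..p + q} -> A -> Prop) :=
  graded_by (fun m n => (m + n)%MM) V.

Definition multigraded_generators (p q : nat) (V : 'X_{1..p + q} -> A -> Prop)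
    (r : nat) (a : 'I_r -> A) (deg : 'I_r -> 'X_{1..p + q}) :=
  generates a /\
  forall i, V (deg i) (a i) /\
    ((part false (a i) /\
      (exists k : 'I_p, deg i (lshift q k) <> 0%N) /\
      (forall j : 'I_q, deg i (rshift p j) = 0%N)) \/
     (part true (a i) /\ exists j : 'I_q, deg i (rshift p j) <> 0%N)).

End Superalgebras.

(* Formal power series over Z are given by their coefficients; products are
   Cauchy products. *)

Section UnivariateSeries.

Definition series_one (n : nat) : int := (n == 0%N)%:R.

Definition series_mul (F G : nat -> int) (n : nat) : int :=
  \sum_(i < n.+1) F i * G (n - i)%N.

(* 1 / (1 - t^d) = \sum_k t^(d k); for d > 0 only the k <= n contribute to the
   coefficient of t^n. *)
Definition series_geom (d n : nat) : int :=
  \sum_(k < n.+1) ((d * k)%N == n)%:R.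

Definition series_inv_prod (ds : seq nat) : nat -> int :=
  foldr (fun d F => series_mul (series_geom d) F) series_one ds.

Lemma series_geomE d n : (0 < d)%N -> series_geom d n = (d %| n)%:R.
Proof.
move=> d0; rewrite /series_geom; case: dvdnP => [[k ->]|nd].
  have kb : (k < (k * d).+1)%N by rewrite ltnS leq_pmulr.
  rewrite (mulnC k) in kb *.
  rewrite (bigD1 (Ordinal kb)) //= eqxx big1 ?addr0 // => i ik.
  rewrite eqn_pmul2l //; case: eqP => // e.
  by case/eqP: ik; apply: val_inj.
rewrite big1 // => i _; case: eqP => // e.
by case: nd; exists i; rewrite mulnC.
Qed.

Lemma series_geomP d n : (0 < d)%N ->
  series_mul (fun i => (1 - 'X^d : {poly int})`_i) (series_geom d) n =
  series_one n.
Proof.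
move=> d0; rewrite /series_mul /series_one.
under eq_bigr => i _ do rewrite coefB coef1 coefXn mulrBl series_geomE //.
rewrite sumrB (bigD1 ord0) //= subn0 mul1r big1 ?addr0; last first.
  by move=> i; rewrite -val_eqE /= => /negPf ->; rewrite mul0r.
have [le_dn|lt_nd] := leqP d n.
  have db : (d < n.+1)%N by rewrite ltnS.
  rewrite (bigD1 (Ordinal db)) //= eqxx mul1r big1 ?addr0; last first.
    by move=> i; rewrite -val_eqE /= => /negPf ->; rewrite mul0r.
  rewrite dvdn_subl // subrr.
  by rewrite -[n == 0%N]negbK -lt0n (leq_trans d0 le_dn).
rewrite big1 ?subr0 => [|i _]; last first.
  by rewrite ltn_eqF ?mul0r // (leq_ltn_trans _ lt_nd) // -ltnS.
by case: n lt_nd => [|n] lt_nd; rewrite ?dvdn0 // gtnNdvd.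
Qed.

End UnivariateSeries.

Section MultivariateSeries.
Variable n : nat.
Implicit Types (m d : 'X_{1..n}) (F G : 'X_{1..n} -> int).

Definition mseries_one m : int := (m == 0%MM)%:R.

Definition mseries_mul F G m : int :=
  \sum_(k : 'X_{1..n < (mdeg m).+1, (mdeg m).+1} | m == (k.1 + k.2)%MM)
    F k.1 * G k.2.

(* 1 / (1 - X^d) = \sum_k X^(d k); for d != 0 only the k <= mdeg m contribute
   to the coefficient of X^m. *)
Definition mseries_geom d m : int :=
  \sum_(k < (mdeg m).+1) ((d *+ k)%MM == m)%:R.

Definition mseries_inv_prod (ds : seq 'X_{1..n}) : 'X_{1..n} -> int :=
  foldr (fun d F => mseries_mul (mseries_geom d) F) mseries_one ds.

Lemma mseries_geom_widen d m N : d != 0%MM -> (mdeg m < N)%N ->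
  mseries_geom d m = (\sum_(k < N) 'X_[d *+ k] : {mpoly int[n]})@_m.
Proof.
move=> d0 mN; rewrite /mseries_geom raddf_sum /=.
under [RHS]eq_bigr => k _ do rewrite mcoeffX.
rewrite (big_ord_widen N (fun k => ((d *+ k)%MM == m)%:R)) //.
rewrite [RHS](bigID (fun k : 'I_N => (k < (mdeg m).+1)%N)) /=.
rewrite [X in _ = _ + X]big1 ?addr0 // => k; rewrite -leqNgt => km.
case: eqP => // e; move: km.
by rewrite -e mdegMn ltnNge leq_pmull // lt0n mdeg_eq0.
Qed.

Lemma mseries_geomP d m : d != 0%MM ->
  mseries_mul (fun k => (1 - 'X_[d] : {mpoly int[n]})@_k) (mseries_geom d) m =
  mseries_one m.
Proof.
move=> d0; pose P : {mpoly int[n]} := \sum_(k < (mdeg m).+1) 'X_[d *+ k].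
transitivity (((1 - 'X_[d]) * P)@_m).
  rewrite mcoeffM; apply: eq_bigr => k _.
  by rewrite (@mseries_geom_widen d k.2 (mdeg m).+1) // bmdeg.
have -> : P = \sum_(k < (mdeg m).+1) 'X_[d] ^+ k.
  by apply: eq_bigr => k _; rewrite mpolyXn.
rewrite -[1 - _]opprB mulNr -subrX1 opprB mpolyXn mcoeffB mcoeff1 mcoeffX.
rewrite [X in _ - X]mulrb ifF ?subr0 //; apply/negP => /eqP e.
have : (mdeg (d *+ (mdeg m).+1)%MM <= mdeg m)%N by rewrite e.
by rewrite mdegMn leqNgt leq_pmull // lt0n mdeg_eq0.
Qed.

End MultivariateSeries.

Definition umonom (p q : nat) (d : 'X_{1..p}) : 'X_{1..p + q} :=
  [multinom (if split i is inl k then d k else 0%N) | i < p + q].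

Definition degree_in (n : nat) (i : 'I_n) (f : {mpoly int[n]}) : nat :=
  \max_(m <- msupp f) m i.

(* Main.v *)
Require Import Defs.
From mathcomp Require Import all_boot all_order all_algebra.
From mathcomp Require Import sesquilinear.
From mathcomp Require Import mpoly.
From mathcomp Require Import zify ring.
From Stdlib Require Import ClassicalEpsilon FunctionalExtensionality.

Set Implicit Arguments.
Unset Strict Implicit.
Unset Printing Implicit Defensive.

Import GRing.Theory.
Local Open Scope ring_scope.

(** Left multiplications by homogeneous elements supercommute, and so do right
    multiplications; from these two rules left and right multiplications commute
    with each other on products ([left_right_comm]).  Hence a word
    l_1 (l_2 (.. ((l_k r_m) .. r_1))) in the generators, with letters on both sides,
    is determined up to sign by how often each generator occurs as a left letter and
    how often as a right letter ([perm_word]), and such words together with the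
    generators span the algebra ([span_generators_words]).  Words are thus indexed by exponent vectors in
    N^(2r).  As the characteristic is not 2, a word in which an odd letter occurs
    twice on the same side vanishes ([word_odd_left], [word_odd_right]), so the
    exponents of odd letters are at most 1.  This is also where the bound on the
    degree in the odd variables comes from: each odd generator is used at most once
    on the left and once on the right ([component_bound]).

    Instead of a module over a polynomial ring and the Hilbert-Serre theorem, the
    proof counts standard monomials.  Order the exponent vectors lexicographically
    and call a word reducible if it is a combination of smaller words of the same
    degree.  In each degree the words that are not reducible form a basis of the
    span of the words ([rank_exponent_list]), and multiplication by a letter keeps
    a word reducible ([reducible_incr]).  So the exponent vectors of standard words
    form the difference of two up-sets of N^(2r): the vectors with at least one letter
    on each side, and the reducible ones.  By Dickson's lemma, in the form of a
    chain condition on up-sets ([upset_chain]), the generating function of such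
    a difference is a polynomial divided by one factor 1 - X^d for each coordinate
    that is not bounded, that is for each even letter ([finsupp_cnt]).  The
    generators themselves change only finitely many dimensions ([hilb_rational]).

    A grading by the positive integers is a multigrading with one variable; there
    the generators have to be split into homogeneous components before the argument
    applies ([homogeneous_generators]). *)

(** * Clearing denominators of power series *)

Section ClearDenominators.
Variable n : nat.
Implicit Types (m d : 'X_{1..n}) (F G : 'X_{1..n} -> int).

Definition shift d F m : int := if (d <= m)%MM then F (m - d)%MM else 0.

(** The product of [F] by the polynomial [\prod_(d <- ds) (1 - X^d)]. *)
Fixpoint clear (ds : seq 'X_{1..n}) F : 'X_{1..n} -> int :=
  if ds is d :: ds' then clear ds' (fun m => F m - shift d F m) else F.

Definition finsupp F := exists N, forall m, (N <= mdeg m)%N -> F m = 0.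

Lemma shiftD d F G : shift d (fun m => F m + G m) =
  fun m => shift d F m + shift d G m.
Proof.
by apply: functional_extensionality => m; rewrite /shift; case: ifP; rewrite ?addr0.
Qed.

Lemma shiftB d F G : shift d (fun m => F m - G m) =
  fun m => shift d F m - shift d G m.
Proof.
by apply: functional_extensionality => m; rewrite /shift; case: ifP; rewrite ?subr0.
Qed.

Lemma lem_subRL d1 d2 m : (d1 <= m)%MM ->
  (d2 <= m - d1)%MM = (d1 + d2 <= m)%MM.
Proof.
move=> /mnm_lepP le1; apply/mnm_lepP/mnm_lepP => h i; move: (h i) (le1 i);
  rewrite mnmDE mnmBE => h1 h2; lia.
Qed.

Lemma shift_shift d1 d2 F : shift d1 (shift d2 F) = shift (d1 + d2)%MM F.
Proof.
apply: functional_extensionality => m; rewrite /shift.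
have [le1|nle1] := boolP (d1 <= m)%MM.
  by rewrite lem_subRL // submDA.
by rewrite ifF //; apply: contraNF nle1; apply: lepm_trans (lem_addr _ _).
Qed.

Lemma clearD ds F G : clear ds (fun m => F m + G m) =
  fun m => clear ds F m + clear ds G m.
Proof.
elim: ds F G => [|d ds IH] F G //=; rewrite -IH shiftD; congr clear.
by apply: functional_extensionality => m; rewrite opprD addrACA.
Qed.

Lemma clearB ds F G : clear ds (fun m => F m - G m) =
  fun m => clear ds F m - clear ds G m.
Proof.
elim: ds F G => [|d ds IH] F G //=; rewrite -IH shiftB; congr clear.
by apply: functional_extensionality => m; ring.
Qed.

Lemma clear_shift ds d F : clear ds (shift d F) = shift d (clear ds F).
Proof.
elim: ds F => [|e ds IH] F //=; rewrite -IH shiftB.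
by rewrite !shift_shift addmC.
Qed.

Lemma clearB1 ds d F : clear (d :: ds) F =
  fun m => clear ds F m - shift d (clear ds F) m.
Proof. by rewrite /= clearB clear_shift. Qed.

Lemma finsuppD F G : finsupp F -> finsupp G -> finsupp (fun m => F m + G m).
Proof.
move=> [N FN] [M GM]; exists (maxn N M) => m; rewrite geq_max => /andP[le1 le2].
by rewrite FN // GM // addr0.
Qed.

Lemma finsupp_shift d F : finsupp F -> finsupp (shift d F).
Proof.
move=> [N FN]; exists (N + mdeg d)%N => m le_m; rewrite /shift; case: ifP => // le_d.
apply: FN; move: le_m; rewrite -{1}(submK le_d) mdegD; lia.
Qed.

Lemma finsupp_clear_cons ds d F : finsupp (clear ds F) -> finsupp (clear (d :: ds) F).
Proof.
rewrite clearB1 => fF; have [N sN] := finsupp_shift d fF; have [M sM] := fF.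
exists (maxn N M) => m; rewrite geq_max => /andP[le1 le2].
by rewrite sM // sN // subr0.
Qed.

Lemma finsupp_clear ds F : finsupp F -> finsupp (clear ds F).
Proof. by move=> fF; elim: ds => // d ds; apply: finsupp_clear_cons. Qed.

(** The factors [1 - X^d] with [d j = 0] cannot raise the degree in the variable
    [j]. *)
Lemma clear_support ds (j : 'I_n) B F :
  (forall d, d \in ds -> d j = 0%N) ->
  (forall m, (B < m j)%N -> F m = 0) -> forall m, (B < m j)%N -> clear ds F m = 0.
Proof.
elim: ds F => [|d ds IH] F d0 FB m Bm; first exact: FB.
apply: IH Bm => [e e_ds|k Bk]; first by apply: d0; rewrite inE e_ds orbT.
rewrite FB // sub0r /shift; case: ifP => _; last by rewrite oppr0.
by rewrite FB ?oppr0 // mnmBE (d0 d) ?mem_head // subn0.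
Qed.

(** Up to any given degree a power series is a polynomial, which transports the
    ring axioms to the Cauchy product. *)
Definition mtrunc N F : {mpoly int[n]} :=
  \sum_(k : 'X_{1..n < N}) F k *: 'X_[k].

Lemma mcoeff_trunc N F m : (mdeg m < N)%N -> (mtrunc N F)@_m = F m.
Proof. exact: mcoeff_mpoly. Qed.

Lemma mseries_mulE N F G (P Q : {mpoly int[n]}) m : (mdeg m < N)%N ->
  (forall k, (mdeg k < N)%N -> P@_k = F k) ->
  (forall k, (mdeg k < N)%N -> Q@_k = G k) ->
  mseries_mul F G m = (P * Q)@_m.
Proof.
move=> mN PF QG; rewrite mcoeffM; apply: eq_bigr => k _.
by rewrite PF ?QG // (leq_ltn_trans _ mN) // -ltnS bmdeg.
Qed.

Lemma mseries_mul_trunc N F G m : (mdeg m < N)%N ->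
  mseries_mul F G m = (mtrunc N F * mtrunc N G)@_m.
Proof. by move=> mN; apply: (mseries_mulE mN) => k; apply: mcoeff_trunc. Qed.

Lemma mseries_mulA F G H :
  mseries_mul F (mseries_mul G H) = mseries_mul (mseries_mul F G) H.
Proof.
apply: functional_extensionality => m; pose N := (mdeg m).+1.
have mN : (mdeg m < N)%N by [].
transitivity ((mtrunc N F * (mtrunc N G * mtrunc N H))@_m).
  apply: (mseries_mulE mN) => k kN; first exact: mcoeff_trunc.
  by symmetry; apply: mseries_mul_trunc.
rewrite mulrA; symmetry; apply: (mseries_mulE mN) => k kN; last exact: mcoeff_trunc.
by symmetry; apply: mseries_mul_trunc.
Qed.

Lemma mseries_mulC F G : mseries_mul F G = mseries_mul G F.
Proof.
apply: functional_extensionality => m.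
by rewrite !(@mseries_mul_trunc (mdeg m).+1) // mulrC.
Qed.

Lemma mseries_mul_poly (P : {mpoly int[n]}) F m :
  mseries_mul (fun k => P@_k) F m = (P * mtrunc (mdeg m).+1 F)@_m.
Proof. by apply: (@mseries_mulE (mdeg m).+1) => // k; apply: mcoeff_trunc. Qed.

Lemma mseries_mul1 F : mseries_mul (@mseries_one n) F = F.
Proof.
apply: functional_extensionality => m.
have -> : @mseries_one n = fun k => (1 : {mpoly int[n]})@_k.
  by apply: functional_extensionality => k; rewrite mcoeff1.
by rewrite mseries_mul_poly mul1r mcoeff_trunc.
Qed.

Lemma mseries_mul1B d F :
  mseries_mul (fun k => (1 - 'X_[d] : {mpoly int[n]})@_k) F =
  fun m => F m - shift d F m.
Proof.
apply: functional_extensionality => m.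
rewrite mseries_mul_poly mulrBl mul1r mcoeffB mcoeff_trunc // /shift; congr (_ - _).
rewrite mulrC; case: ifP => le_d.
  transitivity ((mtrunc (mdeg m).+1 F * 'X_[d])@_(d + (m - d))).
    by rewrite addmC submK.
  by rewrite mcoeffMX mcoeff_trunc // ltnS mdegB.
apply/eqP; apply: contraFT le_d; rewrite -mcoeff_msupp => /msuppM_le.
by case/allpairsP => -[k1 k2] /= [_]; rewrite msuppX inE => /eqP-> ->; apply: lem_addl.
Qed.

(** The geometric series inverts [1 - X^d], so clearing the denominators and then
    restoring them gives the series back. *)
Lemma mseries_clear ds F : (forall d, d \in ds -> d <> 0%MM) ->
  F = mseries_mul (clear ds F) (mseries_inv_prod ds).
Proof.
elim: ds F => [|d ds IH] F ds0; first by rewrite /= mseries_mulC mseries_mul1.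
have d0 : d != 0%MM by apply/eqP/ds0/mem_head.
rewrite /= mseries_mulA [mseries_mul _ (mseries_geom d)]mseries_mulC -mseries_mulA.
rewrite -IH => [|e e_ds]; last by apply: ds0; rewrite inE e_ds orbT.
rewrite -mseries_mul1B mseries_mulA [mseries_mul (mseries_geom d) _]mseries_mulC.
have -> : mseries_mul (fun k => (1 - 'X_[d] : {mpoly int[n]})@_k) (mseries_geom d)
  = @mseries_one n by apply: functional_extensionality => m; apply: mseries_geomP.
by rewrite mseries_mul1.
Qed.

Lemma finsupp_poly F : finsupp F -> exists f : {mpoly int[n]}, forall m, f@_m = F m.
Proof.
move=> [N FN]; exists (mtrunc N F) => m.
have [lt|ge] := ltnP (mdeg m) N; first exact: mcoeff_trunc.
rewrite FN // /mtrunc raddf_sum /= big1 // => k _.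
rewrite mcoeffZ mcoeffX; case: eqP => [e|]; last by rewrite mulr0.
by move: ge; rewrite -e leqNgt bmdeg.
Qed.

End ClearDenominators.

(** * One variable as a special case of several *)

Definition mon1 (i : nat) : 'X_{1..1} := [multinom i | _ < 1].

Lemma mon1E i k : mon1 i k = i.
Proof. by rewrite mnmE. Qed.

Lemma mon1K (m : 'X_{1..1}) : mon1 (m ord0) = m.
Proof. by apply/mnmP => k; rewrite mon1E (ord1 k). Qed.

Lemma mdeg_mon1 i : mdeg (mon1 i) = i.
Proof. by rewrite mdegE big_ord1 mon1E. Qed.

Lemma mon1D i j : (mon1 i + mon1 j)%MM = mon1 (i + j).
Proof. by apply/mnmP => k; rewrite mnmDE !mon1E. Qed.

(** A splitting of the monomial [mon1 n] into two factors is a splitting of [n]. *)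
Lemma series_mul_mon1 F G :
  series_mul (fun i => F (mon1 i)) (fun i => G (mon1 i)) =
  fun i => mseries_mul F G (mon1 i).
Proof.
apply: functional_extensionality => n; rewrite /mseries_mul mdeg_mon1.
pose h (i : 'I_n.+1) : 'X_{1..1 < n.+1, n.+1} :=
  (insubd bm0 (mon1 i), insubd bm0 (mon1 (n - i))).
have h1 i : val (h i).1 = mon1 i by rewrite val_insubd mdeg_mon1 ltn_ord.
have h2 i : val (h i).2 = mon1 (n - i).
  by rewrite val_insubd mdeg_mon1 ltnS leq_subr.
rewrite (reindex h) /=.
  apply: eq_big => [i|i _]; last by rewrite -[bmnm _]/(val _) h1 -[bmnm (h i).2]/(val _) h2.
  rewrite -[bmnm (h i).1]/(val _) h1 -[bmnm (h i).2]/(val _) h2 mon1D.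
  by rewrite subnKC ?eqxx // -ltnS.
exists (fun k : 'X_{1..1 < n.+1, n.+1} => inord ((bmnm k.1) ord0)) => [i _|[k1 k2]].
  by apply: val_inj; rewrite -[bmnm (h i).1]/(val _) h1 mon1E /= inordK.
rewrite inE /= => /eqP/(congr1 (fun m : 'X_{1..1} => m ord0)).
rewrite mon1E mnmDE => e.
have ki : (bmnm k1 ord0 < n.+1)%N by lia.
rewrite [RHS]surjective_pairing [LHS]surjective_pairing; congr pair; apply: val_inj.
  by rewrite h1 inordK // mon1K.
rewrite h2 inordK //= -[RHS]mon1K; congr mon1; lia.
Qed.

Lemma series_geom_mon1 d : series_geom d = fun i => mseries_geom (mon1 d) (mon1 i).
Proof.
apply: functional_extensionality => i; rewrite /mseries_geom /series_geom mdeg_mon1.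
apply: eq_bigr => k _; congr (_%:R); congr nat_of_bool.
apply/eqP/eqP => [e|/(congr1 (fun m : 'X_{1..1} => m ord0))].
  by apply/mnmP => j; rewrite mulmnE !mon1E.
by rewrite mulmnE !mon1E.
Qed.

Lemma series_inv_prod_mon1 ds :
  series_inv_prod ds = fun i => mseries_inv_prod (map mon1 ds) (mon1 i).
Proof.
elim: ds => [|d ds IH] /=; last by rewrite IH series_geom_mon1 series_mul_mon1.
apply: functional_extensionality => i; rewrite /series_one /mseries_one.
by rewrite -mdeg_eq0 mdeg_mon1.
Qed.

(** * Counting lattice points in a difference of two up-sets *)

(** Induction on [k].  The slice of [Q j] at first coordinate [i] increases with [i]
    and with [j], so the diagonal slices [i = j] form a chain in one dimension less;
    once this chain is constant, from [N0] on, so are all the slices with [i >= N0].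
    The slices with [i < N0] form finitely many further chains. *)
Lemma upset_chain k (Q : nat -> seq nat -> Prop) :
  (forall j e i, size e = k -> (i < k)%N -> Q j e -> Q j (incr_nth e i)) ->
  (forall j e, size e = k -> Q j e -> Q j.+1 e) ->
  exists N, forall j e, (N <= j)%N -> size e = k -> Q j e -> Q N e.
Proof.
elim: k Q => [|k IH] Q upQ chQ.
  have [[j Qj]|noQ] := excluded_middle_informative (exists j, Q j [::]).
    by exists j => i e _ /size0nil->.
  by exists 0 => j e _ /size0nil-> Qj; case: noQ; exists j.
have mono i j e : (i <= j)%N -> size e = k.+1 -> Q i e -> Q j e.
  by move=> le_ij se Qi; rewrite -(subnK le_ij); elim: (j - i)%N => // l; apply: chQ.
have monoh i j i' e : (i <= j)%N -> size e = k -> Q i' (i :: e) -> Q i' (j :: e).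
  move=> le_ij se Qi; rewrite -(subnK le_ij); elim: (j - i)%N => // l.
  by apply: (upQ i' (l + i :: e)%N 0%N) => //=; rewrite se.
have up1 i j e l : size e = k -> (l < k)%N -> Q i (j :: e) -> Q i (j :: incr_nth e l).
  by move=> se lk; apply: (upQ i (j :: e) l.+1) => //=; rewrite se.
have [|j e se Qj|N0 diag] := IH (fun j e => Q j (j :: e)).
- by move=> j e i se ik; apply: up1.
- by apply: chQ; rewrite /= ?se //; apply: monoh Qj => //.
have [N [N0N low]] : exists N, (N0 <= N)%N /\
    forall i, (i < N0)%N -> forall j e, (N <= j)%N -> size e = k ->
      Q j (i :: e) -> Q N (i :: e).
  elim: {2}N0 => [|M [N [N0N low]]]; first by exists N0.
  have [|j e se|N1 stab] := IH (fun j e => Q j (M :: e)).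
  - by move=> j e i se ik; apply: up1.
  - by apply: chQ; rewrite /= se.
  exists (maxn N N1); split=> [|i]; first by rewrite leq_max N0N.
  rewrite ltnS leq_eqVlt => /predU1P[->|iM] j e; rewrite geq_max => /andP[Nj N1j] se Qj.
    by apply: (mono N1); rewrite ?leq_maxr //= ?se //; apply: stab Qj.
  by apply: (mono N); rewrite ?leq_maxl //= ?se //; apply: low Qj.
exists N => j [//|i e] Nj [se] Qj.
have [iN0|N0i] := ltnP i N0; first exact: low Qj.
apply: (mono N0); rewrite /= ?se //; apply: (monoh N0) => //.
apply: (diag (maxn i j)) => //; first by rewrite leq_max N0i.
apply: (monoh i); rewrite ?leq_maxl //.
by apply: (mono j); rewrite /= ?leq_maxr ?se.
Qed.

Fixpoint lexlt (e e' : seq nat) : bool :=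
  match e, e' with
  | x :: s, y :: t => (x < y)%N || (x == y) && lexlt s t
  | _, _ => false
  end.

Lemma lexlt_asym e e' : lexlt e e' -> lexlt e' e -> False.
Proof.
elim: e e' => [|x s IH] [|y t] //= /orP[xy|/andP[/eqP-> st]] /orP[yx|/andP[/eqP e ts]].
- lia.
- lia.
- lia.
- exact: IH st ts.
Qed.

Lemma lexlt_irr e : lexlt e e = false.
Proof. by apply/negP => lt_ee; exact: (lexlt_asym lt_ee lt_ee). Qed.

Lemma lexlt_incr e e' i : size e = size e' -> (i < size e)%N ->
  lexlt e e' -> lexlt (incr_nth e i) (incr_nth e' i).
Proof.
elim: e e' i => [|x s IH] [|y t] [|i] //= [st] lt_i /orP[xy|/andP[/eqP-> lt_st]].
- by rewrite xy.
- by rewrite eqxx (IH t) ?orbT.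
Qed.

Section Fibers.
Variable n : nat.
Implicit Types (d m : 'X_{1..n}) (ds : seq 'X_{1..n}) (e : seq nat).

Fixpoint wt ds e : 'X_{1..n} :=
  match ds, e with
  | d :: ds', k :: e' => (d *+ k + wt ds' e')%MM
  | _, _ => 0%MM
  end.

(** Appending one coordinate of weight [d]: the vectors starting with 0, then those
    obtained by raising the first coordinate of a vector of weight [m - d].  When [d]
    is not 0, [mdeg m] steps exhaust the recursion. *)
Fixpoint fiber_head (E : 'X_{1..n} -> seq (seq nat)) d fuel m : seq (seq nat) :=
  map (cons 0%N) (E m) ++
  if fuel is N.+1 then
    if (d <= m)%MM then map (incr_nth^~ 0%N) (fiber_head E d N (m - d)%MM) else [::]
  else [::].

Fixpoint fiber ds m : seq (seq nat) :=
  if ds is d :: ds' then fiber_head (fiber ds') d (mdeg m) m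
  else if m == 0%MM then [:: [::]] else [::].

Lemma fiber_cons d ds m : d <> 0%MM -> fiber (d :: ds) m =
  map (cons 0%N) (fiber ds m) ++
  if (d <= m)%MM then map (incr_nth^~ 0%N) (fiber (d :: ds) (m - d)%MM) else [::].
Proof.
move=> /eqP d0 /=; have fuelP N m' : (mdeg m' <= N)%N ->
    fiber_head (fiber ds) d N m' = fiber_head (fiber ds) d (mdeg m') m'.
  elim/ltn_ind: N m' => N IH m' leN; case: N IH leN => [|N] IH leN.
    by have -> : mdeg m' = 0%N by lia.
  rewrite [LHS]/=; case: ifP => le_d; last first.
    by case: (mdeg m') => //= k; rewrite le_d.
  have dm' := mdegD (m' - d)%MM d; rewrite submK // in dm'.
  have d1 : (0 < mdeg d)%N by rewrite lt0n mdeg_eq0.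
  rewrite [in RHS]dm'; have -> : (mdeg (m' - d) + mdeg d = (mdeg m').-1.+1)%N by lia.
  by rewrite /= le_d !IH //; lia.
case dm: (mdeg m) => [|k] /=.
  have -> : m = 0%MM by apply/eqP; rewrite -mdeg_eq0 dm.
  case: ifP => // /mnm_lepP le0; case/eqP: d0; apply/mnmP => i.
  by have := le0 i; rewrite mnm0E; lia.
case: ifP => // le_d; rewrite fuelP //.
have := mdegD (m - d)%MM d; rewrite submK // dm => e.
have : mdeg d <> 0%N by apply/eqP; rewrite mdeg_eq0.
lia.
Qed.

Lemma fiberP ds m e : (forall d, d \in ds -> d <> 0%MM) ->
  (e \in fiber ds m) = (size e == size ds) && (wt ds e == m).
Proof.
elim: ds m e => [|d ds IH] m e ds0.
  rewrite /=; case: eqP => [->|nm0]; first by case: e => [|x e]; rewrite ?inE ?eqxx.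
  by rewrite in_nil; case: e => //=; case: eqP => // e; case: nm0.
have d0 : d <> 0%MM by apply: ds0; apply: mem_head.
have {}IH m' e' : (e' \in fiber ds m') = (size e' == size ds) && (wt ds e' == m').
  by apply: IH => c c_ds; apply: ds0; rewrite inE c_ds orbT.
have [N mN] := ubnP (mdeg m); elim: N m e mN => // N IHm m e mN.
rewrite fiber_cons // mem_cat.
have -> : (e \in map (cons 0%N) (fiber ds m)) =
    if e is 0%N :: e' then e' \in fiber ds m else false.
  case: e => [|[|x] e].
  - by apply/mapP => -[].
  - by rewrite mem_map // => ? ? [].
  - by apply/mapP => -[? _ []].
case: e => [|x e] /=.
  by case: ifP => // _; apply/mapP => -[[|y e] ye //].
case: ifP => le_d; last first.
  rewrite orbF; case: x => [|x]; first by rewrite IH mulm0n add0m.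
  rewrite mulmS -addmA; apply/esym/andP => -[_ /eqP e_m].
  by move: le_d; rewrite -e_m lem_addr.
have lt_m : (mdeg (m - d) < N)%N.
  have := mdegD (m - d)%MM d; rewrite submK //.
  have : mdeg d <> 0%N by apply/eqP; rewrite mdeg_eq0; apply/eqP.
  lia.
have sizef e' : e' \in fiber (d :: ds) (m - d)%MM -> (0 < size e')%N.
  by rewrite IHm // => /andP[/eqP-> _].
case: x => [|x].
  rewrite IH mulm0n add0m orbC; case: mapP => // -[[|y e'] /sizef //].
have -> : (x.+1 :: e \in map (incr_nth^~ 0%N) (fiber (d :: ds) (m - d)%MM)) =
    (x :: e \in fiber (d :: ds) (m - d)%MM).
  apply/mapP/idP => [[[|y e'] y_in /= //[-> ->]] //|xe]; last by exists (x :: e).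
  by have := sizef _ y_in.
rewrite IHm //= mulmS -addmA; congr andb; apply/eqP/eqP => [->|<-].
  by rewrite addmC submK.
by rewrite [(d + _)%MM]addmC addmK.
Qed.

Lemma fiber_sorted ds m : (forall d, d \in ds -> d <> 0%MM) ->
  pairwise lexlt (fiber ds m).
Proof.
elim: ds m => [|d ds IH] m ds0; first by rewrite /=; case: eqP.
have d0 : d <> 0%MM by apply: ds0; apply: mem_head.
have {}IH m' : pairwise lexlt (fiber ds m').
  by apply: IH => c c_ds; apply: ds0; rewrite inE c_ds orbT.
have [N mN] := ubnP (mdeg m); elim: N m mN => // N IHm m mN.
rewrite fiber_cons // pairwise_cat; apply/and3P; split.
- apply/allrelP => e e' /mapP[s _ ->]; case: ifP => // _ /mapP[[|y t] ht ->] //=.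
- by rewrite pairwise_map; apply: sub_pairwise (IH m) => s t.
case: ifP => // le_d; rewrite pairwise_map.
have lt_m : (mdeg (m - d) < N)%N.
  have := mdegD (m - d)%MM d; rewrite submK //.
  have : mdeg d <> 0%N by apply/eqP; rewrite mdeg_eq0; apply/eqP.
  lia.
apply: (sub_in_pairwise (P := mem (fiber (d :: ds) (m - d)%MM)) _ _ (IHm _ lt_m)).
- move=> s t s_in t_in lt_st.
  have : s \in fiber (d :: ds) (m - d)%MM := s_in; rewrite fiberP // => /andP[/eqP ss _].
  have : t \in fiber (d :: ds) (m - d)%MM := t_in; rewrite fiberP // => /andP[/eqP st _].
  by apply: lexlt_incr; rewrite ?ss ?st.
- by apply/allP.
Qed.

Definition cnt ds (D : pred (seq nat)) m : int := (count D (fiber ds m))%:R.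

Lemma eq_cnt ds (D D' : pred (seq nat)) : (forall d, d \in ds -> d <> 0%MM) ->
  (forall e, size e = size ds -> D e = D' e) -> cnt ds D = cnt ds D'.
Proof.
move=> ds0 DD; apply: functional_extensionality => m; congr (_%:R).
by apply: eq_in_count => e; rewrite fiberP // => /andP[/eqP se _]; apply: DD.
Qed.

(** The points with first coordinate 0, and the others after lowering it by one. *)
Lemma cnt_cons d ds D : d <> 0%MM ->
  cnt (d :: ds) D = fun m =>
    cnt ds (fun e => D (0%N :: e)) m +
    shift d (cnt (d :: ds) (fun e => D (incr_nth e 0))) m.
Proof.
move=> d0; apply: functional_extensionality => m.
rewrite /shift {1}/cnt fiber_cons // count_cat natrD count_map; congr (_ + _).
by case: ifP => // _; rewrite count_map.
Qed.

(** Induction on the number of variables, slicing along the first one: the slices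
    of each up-set form a chain, hence are eventually constant.  The finitely many
    exceptional slices are peeled off one at a time, and a constant family of
    slices contributes a factor [1 / (1 - X^d)]; if the first coordinate is bounded,
    that family is empty and contributes no factor. *)
Lemma finsupp_cnt ds (bs : seq bool) (Q U : seq nat -> Prop) (D : pred (seq nat)) :
  (forall d, d \in ds -> d <> 0%MM) -> size bs = size ds ->
  (forall e i, size e = size ds -> (i < size ds)%N -> Q e -> Q (incr_nth e i)) ->
  (forall e i, size e = size ds -> (i < size ds)%N -> U e -> U (incr_nth e i)) ->
  (forall e, size e = size ds -> D e <-> Q e /\ ~ U e) ->
  (forall e i, size e = size ds -> D e -> nth false bs i -> (nth 0 e i < 2)%N) ->
  finsupp (clear (mask (map negb bs) ds) (cnt ds D)).
Proof.
elim: ds bs Q U D => [|d ds IH] [|b bs] // Q U D ds0.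
  move=> _ _ _ _ _; exists 1%N => m; rewrite /= /cnt /= lt0n mdeg_eq0 => /negPf-> //.
move=> [sbs] upQ upU DQU Db.
have d0 : d <> 0%MM by apply: ds0; apply: mem_head.
have ds0' c : c \in ds -> c <> 0%MM by move=> c_ds; apply: ds0; rewrite inE c_ds orbT.
have chain (P : seq nat -> Prop) : (forall e i, size e = (size ds).+1 ->
      (i < (size ds).+1)%N -> P e -> P (incr_nth e i)) ->
    exists N, forall j e, (N <= j)%N -> size e = size ds -> P (j :: e) <-> P (N :: e).
  move=> upP; have up0 i j e : (i <= j)%N -> size e = size ds -> P (i :: e) -> P (j :: e).
    move=> le_ij se Pi; rewrite -(subnK le_ij); elim: (j - i)%N => // l.
    by apply: (upP (l + i :: e)%N 0%N) => //=; rewrite se.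
  have [|j e se|N stab] := @upset_chain (size ds) (fun j e => P (j :: e)).
  - by move=> j e i se lt_i; apply: (upP (j :: e) i.+1) => //=; rewrite se.
  - exact: up0.
  by exists N => j e Nj se; split; [apply: stab | apply: up0].
have [NQ stQ] := chain Q upQ; have [NU stU] := chain U upU.
have : exists N, forall j e, (N <= j)%N -> size e = size ds -> D (j :: e) = D (N :: e).
  exists (maxn NQ NU) => j e; rewrite geq_max => /andP[Qj Uj] se.
  have [sj sN] : size (j :: e) = size (d :: ds) /\
    size (maxn NQ NU :: e) = size (d :: ds) by rewrite /= se.
  have eQ := stQ _ _ Qj se; have eU := stU _ _ Uj se.
  have eQ' := stQ _ _ (leq_maxl NQ NU) se; have eU' := stU _ _ (leq_maxr NQ NU) se.
  have D1 := DQU _ sj; have D2 := DQU _ sN; apply/idP/idP; tauto.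
move=> [N stD] {chain NQ stQ NU stU}.
elim: N Q U D upQ upU DQU Db stD => [|N IHN] Q U D upQ upU DQU Db stD;
  have slice0 : finsupp (clear (mask (map negb bs) ds) (cnt ds (fun e => D (0%N :: e)))).
- apply: (IH bs (fun e => Q (0%N :: e)) (fun e => U (0%N :: e))) => //.
  + by move=> e i se lt_i; apply: (upQ (0%N :: e) i.+1); rewrite /= ?se.
  + by move=> e i se lt_i; apply: (upU (0%N :: e) i.+1); rewrite /= ?se.
  + by move=> e se; apply: DQU; rewrite /= se.
  + by move=> e i se De; apply: (Db (0%N :: e) i.+1); rewrite /= ?se.
- have eD : cnt (d :: ds) (fun e => D (incr_nth e 0)) = cnt (d :: ds) D.
    by apply: eq_cnt => // -[|x e] //= [se]; rewrite (stD x.+1) // (stD x).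
  case: b Db => Db /=.
    have -> : cnt (d :: ds) D = fun _ => 0.
      apply: functional_extensionality => m; rewrite /cnt.
      rewrite (@eq_in_count _ D pred0) ?count_pred0 // => e.
      rewrite fiberP // => /andP[/eqP + _]; case: e => [//|x e] [se].
      apply/negP => De; have : D (2%N :: e) by rewrite stD // -(stD x).
      by move=> D2; have := Db (2%N :: e) 0%N; rewrite /= se => /(_ erefl D2 isT).
    by apply: finsupp_clear; exists 0%N.
  suff -> : (fun m => cnt (d :: ds) D m - shift d (cnt (d :: ds) D) m)
     = cnt ds (fun e => D (0%N :: e)) by [].
  apply: functional_extensionality => m.
  by rewrite {1}cnt_cons // eD addrK.
- apply: (IH bs (fun e => Q (0%N :: e)) (fun e => U (0%N :: e))) => //.
  + by move=> e i se lt_i; apply: (upQ (0%N :: e) i.+1); rewrite /= ?se.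
  + by move=> e i se lt_i; apply: (upU (0%N :: e) i.+1); rewrite /= ?se.
  + by move=> e se; apply: DQU; rewrite /= se.
  + by move=> e i se De; apply: (Db (0%N :: e) i.+1); rewrite /= ?se.
rewrite cnt_cons // clearD clear_shift; apply: finsuppD.
  by case: (b) => //=; apply: finsupp_clear_cons.
apply: finsupp_shift.
have incr_size e : size e = (size ds).+1 -> size (incr_nth e 0) = (size ds).+1.
  by case: e.
have incrC e i : size e = (size ds).+1 ->
    incr_nth (incr_nth e i) 0 = incr_nth (incr_nth e 0) i by case: e i => [|x e] [|i].
apply: (IHN (fun e => Q (incr_nth e 0)) (fun e => U (incr_nth e 0))).
- by move=> e i se lt_i; rewrite incrC //; apply: upQ => //; apply: incr_size.
- by move=> e i se lt_i; rewrite incrC //; apply: upU => //; apply: incr_size.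
- by move=> e se; apply: DQU; apply: incr_size.
- move=> [|x e] i se // /Db + bi => /(_ i (incr_size _ se) bi).
  by case: (i) => [|k] //=; lia.
- by move=> j e Nj se /=; apply: stD.
Qed.

End Fibers.

(** * Spans and dimensions *)

Definition classically_true (P : Prop) : bool :=
  if excluded_middle_informative P then true else false.

Lemma classically_trueP P : reflect P (classically_true P).
Proof. by rewrite /classically_true; case: excluded_middle_informative => h; constructor. Qed.

Section Span.
Variables (K : fieldType) (E : lmodType K).
Implicit Types (S P : E -> Prop) (s : seq E) (x y : E).

Definition lspan S x := forall P, subspace P -> (forall y, S y -> P y) -> P x.

Lemma mem_lspan S x : S x -> lspan S x.
Proof. by move=> Sx P _; apply. Qed.

Lemma lspan_subspace S : subspace (lspan S).
Proof.
split=> [P [P0 _] _ //|c x y Sx Sy P sP SP].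
by apply: (proj2 sP); [apply: Sx | apply: Sy].
Qed.

Lemma lspan_min S P : subspace P -> (forall x, S x -> P x) -> forall x, lspan S x -> P x.
Proof. by move=> sP SP x; apply. Qed.

Lemma sub_lspan S S' : (forall x, S x -> S' x) -> forall x, lspan S x -> lspan S' x.
Proof.
by move=> SS; apply: lspan_min (lspan_subspace S') _ => x /SS; apply: mem_lspan.
Qed.

Lemma subspaceZ P c x : subspace P -> P x -> P (c *: x).
Proof. by move=> [P0 PP] Px; rewrite -[_ *: _]addr0; apply: PP. Qed.

Lemma subspaceD P x y : subspace P -> P x -> P y -> P (x + y).
Proof. by move=> [P0 PP] Px Py; rewrite -[x]scale1r; apply: PP. Qed.

Lemma subspace_sum P (I : Type) (l : seq I) (C : pred I) (F : I -> E) :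
  subspace P -> (forall i, C i -> P (F i)) -> P (\sum_(i <- l | C i) F i).
Proof.
move=> sP PF; elim/big_rec: _ => [|i x Ci Px]; first exact: (proj1 sP).
by apply: subspaceD => //; apply: PF.
Qed.

Definition in_span s := lspan (fun y => y \in s).

Lemma in_span_cons x s y : in_span (x :: s) y -> exists c z, in_span s z /\ y = c *: x + z.
Proof.
move: y; apply: lspan_min => [|y].
  split=> [|k y1 y2 [c1 [z1 [sz1 ->]]] [c2 [z2 [sz2 ->]]]].
    by exists 0, 0; rewrite scale0r addr0; split=> //; apply: (proj1 (lspan_subspace _)).
  exists (k * c1 + c2), (k *: z1 + z2); split; first exact: (proj2 (lspan_subspace _)).
  by rewrite scalerDr scalerA scalerDl addrACA.
rewrite inE => /predU1P[->|ys].
  by exists 1, 0; rewrite scale1r addr0; split=> //; apply: (proj1 (lspan_subspace _)).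
by exists 0, y; rewrite scale0r add0r; split=> //; apply: mem_lspan.
Qed.

(** Rank computed along the list, so that the basis it selects can be identified
    entry by entry. *)
Fixpoint rank s : nat :=
  if s is x :: s' then ~~ classically_true (in_span s' x) + rank s' else 0.

Lemma has_dim_ext (V W : E -> Prop) n : (forall x, V x <-> W x) -> has_dim V n -> has_dim W n.
Proof.
move=> VW [b [Vb fb gb]]; exists b; split=> // [i|x /VW]; [exact/VW | exact: gb].
Qed.

Lemma has_dim_span s : has_dim (in_span s) (rank s).
Proof.
elim: s => [|x s [b [sb freeb genb]]] /=.
  exists (fun=> 0); split=> [[]//|c _ [] //|x sx]; exists (fun=> 0).
  have sub0 : subspace (fun y : E => y = 0).
    by split=> // c y z -> ->; rewrite scaler0 addr0.
  by rewrite big_ord0; apply: (sx _ sub0) => y; rewrite in_nil.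
have sub_cons y : in_span s y -> in_span (x :: s) y.
  by apply: sub_lspan => z; rewrite inE orbC => ->.
case: classically_trueP => [sx|nsx] /=.
  apply: (@has_dim_ext (in_span s)) => [y|]; last by exists b.
  split=> [|/in_span_cons [c [z [sz ->]]]]; first exact: sub_cons.
  exact: (proj2 (lspan_subspace _)).
pose b' (i : 'I_(1 + rank s)) := if unlift ord0 i is Some j then b j else x.
have sumE c : \sum_i c i *: b' i = c ord0 *: x + \sum_j c (lift ord0 j) *: b j.
  rewrite big_ord_recl /b' unlift_none; congr (_ + _).
  by apply: eq_bigr => j _; rewrite liftK.
exists b'; split=> [i|c|y /in_span_cons [c [z [sz ->]]]].
- rewrite /b'; case: unliftP => [j _|_]; first by apply: sub_cons.
  by apply: mem_lspan; rewrite mem_head.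
- rewrite sumE; have [c0|c0 e] := eqVneq (c ord0) 0.
    rewrite c0 scale0r add0r => /freeb c1 i.
    by case: (unliftP ord0 i) => [j ->|->].
  case: nsx; have -> : x = - (c ord0)^-1 *: \sum_j c (lift ord0 j) *: b j.
    apply: (scalerI c0); rewrite scalerA mulrN mulfV // scaleN1r.
    by apply/eqP; rewrite -addr_eq0 e.
  have sS : subspace (in_span s) := lspan_subspace _.
  apply: (subspaceZ _ sS); apply: (subspace_sum _ sS) => j _.
  exact: (subspaceZ _ sS).
have [c' ->] := genb z sz.
exists (fun i => if unlift ord0 i is Some j then c' j else c); rewrite sumE unlift_none.
by congr (_ + _); apply: eq_bigr => j _; rewrite liftK.
Qed.

Lemma has_dim_trivial (V : E -> Prop) n :
  has_dim V n -> (forall x, V x -> x = 0) -> n = 0%N.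
Proof.
case: n => // n [b [Vb freeb _]] V0.
have /freeb/(_ ord0)/eqP : \sum_i (1 : K) *: b i = 0.
  by rewrite big1 // => i _; rewrite (V0 _ (Vb i)) scaler0.
by rewrite oner_eq0.
Qed.

Lemma rank_map (T : eqType) (w : T -> E) (D : pred T) (l : seq T) :
  (forall l1 (t : T) l2, l = l1 ++ t :: l2 -> D t <-> ~ in_span (map w l2) (w t)) ->
  rank (map w l) = count D l.
Proof.
elim: l => //= x l IH Dl; rewrite IH => [|l1 y l2 e]; last by apply: (Dl (x :: l1)); rewrite e.
have Dx := Dl [::] x l erefl; congr (_ + _)%N; congr nat_of_bool.
by apply/idP/idP => [/classically_trueP/Dx //|/Dx h]; apply/classically_trueP.
Qed.

End Span.

(** * Exponent vectors and their letters *)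

Lemma count2_perm (T : eqType) (i : T) s : (1 < count_mem i s)%N ->
  exists s', perm_eq s [:: i, i & s'].
Proof.
move=> c2; have i_s : i \in s by rewrite -has_pred1 has_count; lia.
have p1 := perm_to_rem i_s; have i_rem : i \in rem i s.
  rewrite -has_pred1 has_count; move: c2; rewrite (permP p1) /= eqxx; lia.
exists (rem i (rem i s)); rewrite (permPl p1) perm_cons; exact: perm_to_rem.
Qed.

Section Letters.
Variable r : nat.
Implicit Types (i k : 'I_r) (e : seq nat).

Definition letters (f : 'I_r -> nat) : seq 'I_r :=
  flatten [seq nseq (f i) i | i <- enum 'I_r].

Lemma count_letters f k : count_mem k (letters f) = f k.
Proof.
rewrite count_flatten sumnE big_map big_map big_enum /=.
rewrite (bigD1 k) //= count_nseq /= eqxx mul1n big1 ?addn0 // => i /negPf ik.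
by rewrite count_nseq /= ik.
Qed.

Lemma perm_letters f s : (forall k, count_mem k s = f k) -> perm_eq (letters f) s.
Proof. by move=> fs; apply/allP => k _ /=; rewrite count_letters fs. Qed.

(** Exponent vectors have length [r + r]: the first half counts the left letters,
    the second half the right letters. *)
Definition lletters (e : seq nat) := letters (fun i => nth 0%N e i).
Definition rletters (e : seq nat) := letters (fun i => nth 0%N e (r + i)).
Definition two_sided e := lletters e != [::] /\ rletters e != [::].

Lemma lletters_incr e i : perm_eq (lletters (incr_nth e i)) (i :: lletters e).
Proof.
by apply: perm_letters => k; rewrite /= count_letters nth_incr_nth -val_eqE.
Qed.

Lemma rletters_incr e i : perm_eq (rletters (incr_nth e (r + i))) (i :: rletters e).
Proof.
by apply: perm_letters => k; rewrite /= count_letters nth_incr_nth eqn_add2l -val_eqE.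
Qed.

Lemma lletters_incrr e i : lletters (incr_nth e (r + i)) = lletters e.
Proof.
rewrite /lletters /letters; congr flatten; apply: eq_map => k; congr nseq.
by rewrite nth_incr_nth; case: eqP (ltn_ord k) => //; lia.
Qed.

Lemma rletters_incrl e i : rletters (incr_nth e i) = rletters e.
Proof.
rewrite /rletters /letters; congr flatten; apply: eq_map => k; congr nseq.
by rewrite nth_incr_nth; case: eqP (ltn_ord i) => //; lia.
Qed.

Lemma perm_nil0 (s : seq 'I_r) i s' : perm_eq s (i :: s') -> s != [::].
Proof. by move=> p; rewrite -size_eq0 (perm_size p). Qed.

Lemma two_sided_incrl e i : two_sided e -> two_sided (incr_nth e i).
Proof.
by case=> l0 r0; split; rewrite ?rletters_incrl //; apply: perm_nil0 (lletters_incr e i).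
Qed.

Lemma two_sided_incrr e i : two_sided e -> two_sided (incr_nth e (r + i)).
Proof.
by case=> l0 r0; split; rewrite ?lletters_incrr //; apply: perm_nil0 (rletters_incr e i).
Qed.

End Letters.

(** * Words in a bicommutative superalgebra *)

Section Words.
Variable K : fieldType.
Variables (A : superalgebra K) (bicA : bicommutative A).
Local Notation "x ** y" := (smul A x y) (at level 40, left associativity).
Implicit Types (x y z t : A).

Definition homogeneous x := exists b, part b x.

Lemma homogeneousM x y : homogeneous x -> homogeneous y -> homogeneous (x ** y).
Proof. by move=> [b xb] [c yc]; exists (b (+) c); apply: part_smul. Qed.

Definition eq_sign x y := exists b : bool, x = (-1) ^+ b *: y.

Lemma eq_sign_refl x : eq_sign x x.
Proof. by exists false; rewrite expr0 scale1r. Qed.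

Lemma eq_sign_sym x y : eq_sign x y -> eq_sign y x.
Proof. by move=> [b ->]; exists b; rewrite scalerA -signr_addb addbb scale1r. Qed.

Lemma eq_sign_trans y x z : eq_sign x y -> eq_sign y z -> eq_sign x z.
Proof. by move=> [b ->] [c ->]; exists (b (+) c); rewrite scalerA signr_addb. Qed.

Lemma eq_signMl z x y : eq_sign x y -> eq_sign (z ** x) (z ** y).
Proof. by move=> [b ->]; exists b; rewrite linearZr_LR. Qed.

Lemma eq_signMr z x y : eq_sign x y -> eq_sign (x ** z) (y ** z).
Proof. by move=> [b ->]; exists b; rewrite linearZl_LR. Qed.

Lemma eq_sign0 x : eq_sign x 0 -> x = 0.
Proof. by move=> [b ->]; rewrite scaler0. Qed.

Lemma eq_sign_subspace (P : A -> Prop) x y : subspace P -> eq_sign x y -> P y -> P x.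
Proof. by move=> sP [b ->]; apply: subspaceZ. Qed.

Lemma left_comm x y z : homogeneous x -> homogeneous y -> homogeneous z ->
  eq_sign (x ** (y ** z)) (y ** (x ** z)).
Proof.
by move=> [i xi] [j yj] [k zk]; exists (i && j); case: (bicA xi yj zk).
Qed.

Lemma right_comm x y z : homogeneous x -> homogeneous y -> homogeneous z ->
  eq_sign (x ** y ** z) (x ** z ** y).
Proof.
by move=> [i xi] [j yj] [k zk]; exists (j && k); case: (bicA xi yj zk).
Qed.

(** Eight applications of the two supercommutation rules lead from one side to the
    other, through [(x ** z) ** (y ** t)]; each pair of arguments is exchanged an
    even number of times on the way, so no sign remains. *)
Lemma left_right_comm x y z t :
  homogeneous x -> homogeneous y -> homogeneous z -> homogeneous t ->
  x ** (y ** z ** t) = x ** (y ** z) ** t.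
Proof.
move=> [p xp] [q yq] [s zs] [u tu].
have M := part_smul.
have [e1 _] := bicA xp (M _ _ _ _ _ _ yq zs) tu.
have [_ e2] := bicA yq zs (M _ _ _ _ _ _ xp tu).
have [e3 _] := bicA yq xp tu.
have [_ e4] := bicA xp (M _ _ _ _ _ _ yq tu) zs.
have [e5 _] := bicA (M _ _ _ _ _ _ xp zs) yq tu.
have [_ e6] := bicA xp zs tu.
have [e7 _] := bicA yq (M _ _ _ _ _ _ xp tu) zs.
have [_ e8] := bicA xp tu (M _ _ _ _ _ _ yq zs).
rewrite e1 e2 e3 linearZl_LR e4 e5 e6 linearZr_LR e7 e8 !scalerA.
rewrite -!signr_addb.
by case: p q s u {xp yq zs tu e1 e2 e3 e4 e5 e6 e7 e8} => [] [] [] []; rewrite /= scale1r.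
Qed.

Variables (r : nat) (a : 'I_r -> A) (odda : 'I_r -> bool).
Hypothesis a_odd : forall i, part (odda i) (a i).
Implicit Types (i j k : 'I_r) (ls rs : seq 'I_r) (e : seq nat).

Fixpoint right_word i rs : A := if rs is k :: rs' then right_word i rs' ** a k else a i.

(** The word [l1 (l2 (.. ((lk r_m) .. r_1)))] for [ls = [:: l1; ..; lk]] and
    [rs = [:: r_1; ..; r_m]]: the last left letter starts the word, so it stands
    for no element when [ls] is empty. *)
Fixpoint word ls rs : A :=
  match ls with
  | [::] => 0
  | i :: ls' => if ls' is [::] then right_word i rs else a i ** word ls' rs
  end.

Lemma word_cons i ls rs : ls != [::] -> word (i :: ls) rs = a i ** word ls rs.
Proof. by case: ls. Qed.

Lemma word_closed (P : A -> Prop) ls rs :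
  (forall i, P (a i)) -> (forall x y, P x -> P y -> P (x ** y)) ->
  ls != [::] -> P (word ls rs).
Proof.
move=> Pa PM; have Pr i : P (right_word i rs) by elim: rs => //= k l Pl; apply: PM.
elim: ls => // i [|k ls] IH _ //=; apply: PM => //; exact: IH.
Qed.

Lemma homogeneous_a i : homogeneous (a i).
Proof. by exists (odda i). Qed.

Lemma homogeneous_word ls rs : ls != [::] -> homogeneous (word ls rs).
Proof. exact: (word_closed rs homogeneous_a homogeneousM). Qed.

Lemma homogeneous_right_word i rs : homogeneous (right_word i rs).
Proof. exact: (@homogeneous_word [:: i] rs). Qed.

Lemma word_mul2 ls rs : ls != [::] -> rs != [::] ->
  exists x y, [/\ homogeneous x, homogeneous y & word ls rs = x ** y].
Proof.
case: ls => // i [|k ls] _; case: rs => // j rs _.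
  exists (right_word i rs), (a j); split=> //; first exact: homogeneous_right_word.
  exact: homogeneous_a.
exists (a i), (word (k :: ls) (j :: rs)); split=> //; first exact: homogeneous_a.
exact: homogeneous_word.
Qed.

(** A right letter travels inwards through the left letters until it reaches the
    first letter of the word. *)
Lemma word_consr j ls rs : ls != [::] -> rs != [::] ->
  word ls (j :: rs) = word ls rs ** a j.
Proof.
move=> + rs0; elim: ls => // i [|k ls] IH _ //.
rewrite !(word_cons i) // IH //.
have [//|//|x [y [hx hy ->]]] := @word_mul2 (k :: ls) rs.
by rewrite left_right_comm //; apply: homogeneous_a.
Qed.

(** Two adjacent left letters supercommute directly unless the second one starts the
    word; then the right letters are moved out first, which leaves a product of the
    form [x (y z)]. *)
Lemma word_swapl i k ls rs : rs != [::] ->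
  word [:: i, k & ls] rs = (-1) ^+ (odda i && odda k) *: word [:: k, i & ls] rs.
Proof.
case: ls => [|l ls] rs0; last first.
  have [b hb] := @homogeneous_word (l :: ls) rs isT.
  by have [/= -> _] := bicA (a_odd i) (a_odd k) hb.
elim: rs rs0 => // j [|j' rs] IH _.
  by have [/= -> _] := bicA (a_odd i) (a_odd k) (a_odd j).
rewrite !(word_consr j) // IH //.
by rewrite linearZl_LR.
Qed.

Lemma word_swapr j k ls rs : ls != [::] ->
  word ls [:: j, k & rs] = (-1) ^+ (odda k && odda j) *: word ls [:: k, j & rs].
Proof.
elim: ls => // i [|i' ls] IH _.
  have [b hb] := homogeneous_right_word i rs.
  by have [_ /= ->] := bicA hb (a_odd k) (a_odd j).
by rewrite !(word_cons i) // IH // linearZr_LR.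
Qed.

(** Adjacent swaps bring any letter to the front, hence realise every permutation. *)
Lemma word_frontl i ls rs : rs != [::] -> i \in ls ->
  eq_sign (word ls rs) (word (i :: rem i ls) rs).
Proof.
move=> rs0; elim: ls => // k ls IH; rewrite inE eq_sym [rem i _]/=.
have [->|ki] := eqVneq k i => [_|i_ls]; first exact: eq_sign_refl.
have ls0 : ls != [::] by case: (ls) i_ls.
rewrite word_cons //; apply: eq_sign_trans (eq_signMl _ (IH i_ls)) _.
by rewrite -word_cons //; exists (odda k && odda i); apply: word_swapl.
Qed.

Lemma word_frontr j ls rs : ls != [::] -> j \in rs ->
  eq_sign (word ls rs) (word ls (j :: rem j rs)).
Proof.
move=> ls0; elim: rs => // k rs IH; rewrite inE eq_sym [rem j _]/=.
have [->|kj] := eqVneq k j => [_|j_rs]; first exact: eq_sign_refl.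
have rs0 : rs != [::] by case: (rs) j_rs.
rewrite word_consr //; apply: eq_sign_trans (eq_signMr _ (IH j_rs)) _.
by rewrite -word_consr //; exists (odda j && odda k); apply: word_swapr.
Qed.

Lemma perm_wordl ls ls' rs : rs != [::] -> perm_eq ls ls' ->
  eq_sign (word ls rs) (word ls' rs).
Proof.
move=> rs0; elim: ls' ls => [|i ls' IH] ls pls.
  by rewrite (perm_nilP pls); apply: eq_sign_refl.
have i_ls : i \in ls by rewrite (perm_mem pls) mem_head.
apply: eq_sign_trans (word_frontl rs0 i_ls) _.
have prem : perm_eq (rem i ls) ls'.
  by rewrite -(perm_cons i) -(permPl (perm_to_rem i_ls)).
have [e|ls'0] := eqVneq ls' [::].
  by move: prem; rewrite e => /perm_nilP->; apply: eq_sign_refl.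
rewrite !word_cons //; first by apply: eq_signMl; apply: IH.
by rewrite -size_eq0 (perm_size prem) size_eq0.
Qed.

Lemma perm_wordr ls rs rs' : ls != [::] -> perm_eq rs rs' ->
  eq_sign (word ls rs) (word ls rs').
Proof.
move=> ls0; elim: rs' rs => [|i rs' IH] rs prs.
  by rewrite (perm_nilP prs); apply: eq_sign_refl.
have i_rs : i \in rs by rewrite (perm_mem prs) mem_head.
apply: eq_sign_trans (word_frontr ls0 i_rs) _.
have prem : perm_eq (rem i rs) rs'.
  by rewrite -(perm_cons i) -(permPl (perm_to_rem i_rs)).
have [e|rs'0] := eqVneq rs' [::].
  by move: prem; rewrite e => /perm_nilP->; apply: eq_sign_refl.
rewrite !word_consr //; first by apply: eq_signMr; apply: IH.
by rewrite -size_eq0 (perm_size prem) size_eq0.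
Qed.

Lemma perm_word ls ls' rs rs' : ls != [::] -> rs != [::] ->
  perm_eq ls ls' -> perm_eq rs rs' -> eq_sign (word ls rs) (word ls' rs').
Proof.
move=> ls0 rs0 pls prs; apply: eq_sign_trans (perm_wordl rs0 pls) _.
by apply: perm_wordr prs; rewrite -size_eq0 -(perm_size pls) size_eq0.
Qed.

Hypothesis charK : 2%N \notin [pchar K].

Lemma oppr_eq_self x : x = - x -> x = 0.
Proof.
move/eqP; rewrite -subr_eq0 opprK -mulr2n -scaler_nat scaler_eq0 => /orP[|/eqP//].
by move: charK; rewrite inE /= => /negPf->.
Qed.

(** Swapping the two occurrences multiplies the word by -1 and leaves it as it is. *)
Lemma word_odd_left i ls rs : rs != [::] -> odda i -> (1 < count_mem i ls)%N ->
  word ls rs = 0.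
Proof.
move=> rs0 oi /count2_perm [s pls].
apply: eq_sign0; apply: eq_sign_trans (perm_wordl rs0 pls) _.
suff -> : word [:: i, i & s] rs = 0 by apply: eq_sign_refl.
by apply: oppr_eq_self; rewrite {1}word_swapl // oi scaleN1r.
Qed.

Lemma word_odd_right i ls rs : ls != [::] -> odda i -> (1 < count_mem i rs)%N ->
  word ls rs = 0.
Proof.
move=> ls0 oi /count2_perm [s prs].
apply: eq_sign0; apply: eq_sign_trans (perm_wordr ls0 prs) _.
suff -> : word ls [:: i, i & s] = 0 by apply: eq_sign_refl.
by apply: oppr_eq_self; rewrite {1}word_swapr // oi scaleN1r.
Qed.

Definition is_word x := exists ls rs, [/\ ls != [::], rs != [::] & x = word ls rs].

Lemma subspace_mull (P : A -> Prop) x : subspace P -> subspace (fun y => P (x ** y)).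
Proof.
move=> [P0 PP]; split=> [|c y z Py Pz]; first by rewrite linear0r.
by rewrite linearPr; apply: PP.
Qed.

Lemma subspace_mulr (P : A -> Prop) x : subspace P -> subspace (fun y => P (y ** x)).
Proof.
move=> [P0 PP]; split=> [|c y z Py Pz]; first by rewrite linear0l.
by rewrite linearPl; apply: PP.
Qed.

Lemma subspace_cap (P P' : A -> Prop) : subspace P -> subspace P' ->
  subspace (fun y => P y /\ P' y).
Proof.
move=> [P0 PP] [P'0 PP']; split=> // c y z [Py P'y] [Pz P'z].
by split; [apply: PP | apply: PP'].
Qed.

(** The homogeneous elements whose left and right multiplications preserve the span
    of the words are closed under products, by the two supercommutation rules; so
    multiplication by any word preserves it. *)
Lemma is_wordM x y : is_word x -> is_word y -> lspan is_word (x ** y).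
Proof.
pose N := lspan is_word; have sN : subspace N := lspan_subspace _.
pose stable x := homogeneous x /\ forall y, N y -> N (x ** y) /\ N (y ** x).
have stable_a i : stable (a i).
  split; first exact: homogeneous_a.
  apply: lspan_min => [|_ [ls [rs [ls0 rs0 ->]]]].
    by apply: subspace_cap; [apply: subspace_mull | apply: subspace_mulr].
  split; apply: mem_lspan.
    by exists (i :: ls), rs; rewrite word_cons.
  by exists ls, (i :: rs); rewrite word_consr.
have stableM u v : stable u -> stable v -> stable (u ** v).
  move=> [hu su] [hv sv]; split; first exact: homogeneousM.
  apply: lspan_min => [|w ww].
    by apply: subspace_cap; [apply: subspace_mull | apply: subspace_mulr].
  have hw : homogeneous w by case: ww => ls [rs [ls0 rs0 ->]]; apply: homogeneous_word.
  have Nw : N w by apply: mem_lspan.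
  split.
    apply: eq_sign_subspace (right_comm hu hv hw) _ => //.
    by apply: (proj2 (sv _ _)); apply: (proj1 (su _ _)).
  apply: eq_sign_subspace (left_comm hw hu hv) _ => //.
  by apply: (proj1 (su _ _)); apply: (proj2 (sv _ _)).
move=> [ls [rs [ls0 rs0 ->]]] yw.
have [_ sx] := word_closed rs stable_a stableM ls0.
by apply: (proj1 (sx _ _)); apply: mem_lspan.
Qed.

Lemma span_generators_words : generates a ->
  forall x, lspan (fun y => (exists i, y = a i) \/ is_word y) x.
Proof.
set S := fun y => _; have sS : subspace (lspan S) := lspan_subspace _.
have wS x : lspan is_word x -> lspan S x by apply: sub_lspan => y; right.
apply=> // [x y Sx Sy|i]; last by apply: mem_lspan; left; exists i.
move: x Sx; apply: lspan_min => [|x Sx]; first exact: subspace_mulr.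
move: y Sy; apply: lspan_min => [|y Sy]; first exact: subspace_mull.
case: Sx Sy => [[i ->]|xw] [[j ->]|yw].
- by apply: mem_lspan; right; exists [:: i], [:: j].
- apply: mem_lspan; right; case: yw => ls [rs [ls0 rs0 ->]].
  by exists (i :: ls), rs; rewrite word_cons.
- apply: mem_lspan; right; case: xw => ls [rs [ls0 rs0 ->]].
  by exists ls, (j :: rs); rewrite word_consr.
- by apply: wS; apply: is_wordM.
Qed.

Definition monomial e := word (lletters r e) (rletters r e).

Lemma monomial_incrl e i : two_sided r e ->
  eq_sign (monomial (incr_nth e i)) (a i ** monomial e).
Proof.
move=> [l0 r0]; rewrite /monomial rletters_incrl -word_cons //.
exact: perm_wordl (lletters_incr e i).
Qed.

Lemma monomial_incrr e i : two_sided r e ->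
  eq_sign (monomial (incr_nth e (r + i))) (monomial e ** a i).
Proof.
move=> [l0 r0]; rewrite /monomial lletters_incrr -word_consr //.
exact: perm_wordr (rletters_incr e i).
Qed.

Lemma monomial_odd_left e i : two_sided r e -> odda i -> (1 < nth 0 e i)%N -> monomial e = 0.
Proof.
by move=> [l0 r0] oi c2; apply: (@word_odd_left i) => //; rewrite count_letters.
Qed.

Lemma monomial_odd_right e i :
  two_sided r e -> odda i -> (1 < nth 0 e (r + i))%N -> monomial e = 0.
Proof.
by move=> [l0 r0] oi c2; apply: (@word_odd_right i) => //; rewrite count_letters.
Qed.

Lemma is_word_monomial x : is_word x ->
  exists e, [/\ size e = (r + r)%N, two_sided r e & eq_sign x (monomial e)].
Proof.
move=> [ls [rs [ls0 rs0 ->]]].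
pose counts (s : seq 'I_r) := [seq count_mem k s | k <- enum 'I_r].
pose e := counts ls ++ counts rs.
have sz (s : seq 'I_r) : size (counts s) = r.
  by rewrite size_map size_enum_ord.
have pl : perm_eq (lletters r e) ls.
  apply: perm_letters => k; rewrite nth_cat sz ltn_ord (nth_map k) ?size_enum_ord //.
  by rewrite nth_ord_enum.
have pr : perm_eq (rletters r e) rs.
  apply: perm_letters => k; rewrite nth_cat sz ltnNge leq_addr /= addKn.
  by rewrite (nth_map k) ?size_enum_ord // nth_ord_enum.
exists e; split; first by rewrite size_cat !sz.
  by split; rewrite -size_eq0 ?(perm_size pl) ?(perm_size pr) size_eq0.
by apply: perm_word; rewrite // perm_sym.
Qed.

End Words.

(** * The Hilbert function of a multigraded bicommutative superalgebra *)

Section DirectSum.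
Variables (K : fieldType) (E : lmodType K) (I : eqType) (V : I -> E -> Prop).
Hypothesis dirV : direct_sum_decomposition V.

Lemma component_subspace i : subspace (V i).
Proof. by case: dirV. Qed.

Lemma component_disjoint i j x : i != j -> V i x -> V j x -> x = 0.
Proof.
case: dirV => sV _ freeV ij Vi Vj.
pose y k := if k == i then x else if k == j then - x else 0.
have Vy k : V k (y k).
  rewrite /y; case: eqP => [->//|_]; case: eqP => [->|_]; last exact: (proj1 (sV k)).
  by rewrite -scaleN1r; apply: subspaceZ (sV j) _.
have := freeV [:: i; j] y _ Vy _ i; rewrite /= !inE eqxx ij => /(_ isT).
rewrite !big_cons big_nil addr0 /y eqxx [j == i]eq_sym (negPf ij) eqxx subrr.
by move=> /(_ erefl isT).
Qed.

(** Projecting onto a component: a combination of homogeneous elements that lies in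
    a component only involves the elements of that component. *)
Lemma lspan_component (S : E -> Prop) m x :
  (forall y, S y -> exists i, V i y) -> lspan S x -> V m x ->
  lspan (fun y => S y /\ V m y) x.
Proof.
case: dirV => sV _ freeV SV Sx Vx; pose T i := lspan (fun y => S y /\ V i y).
have sT i : subspace (T i) := lspan_subspace _.
have TV i y : T i y -> V i y by move: y; apply: lspan_min => // y [].
pose P x := exists (s : seq I) (y : I -> E), [/\ uniq s, forall i, T i (y i),
  forall i, i \notin s -> y i = 0 & x = \sum_(i <- s) y i].
have widen (s s' : seq I) (y : I -> E) : uniq s -> uniq s' -> {subset s <= s'} ->
    (forall i, i \notin s -> y i = 0) -> \sum_(i <- s) y i = \sum_(i <- s') y i.
  move=> us us' ss' y0; rewrite [RHS](bigID (mem s)) /= addrC [X in _ = X + _]big1 ?add0r.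
    2: by move=> i; apply: y0.
  rewrite -[RHS]big_filter; apply: perm_big; apply: uniq_perm => //.
    exact: filter_uniq.
  move=> i; rewrite mem_filter; apply/idP/idP => [i_s|/andP[]//].
  by apply/andP; split; [|apply: ss'].
have [s [y [us Ty y0 ex]]] : P x.
  move: (x) Sx; apply: lspan_min => [|z Sz].
    split=> [|c x1 x2 [s1 [y1 [us1 Ty1 y10 ->]]] [s2 [y2 [us2 Ty2 y20 ->]]]].
      by exists [::], (fun=> 0); rewrite big_nil; split=> // i; apply: (proj1 (sT i)).
    exists (undup (s1 ++ s2)), (fun i => c *: y1 i + y2 i); split.
    - exact: undup_uniq.
    - by move=> i; apply: (proj2 (sT i)).
    - move=> i; rewrite mem_undup mem_cat negb_or => /andP[i1 i2].
      by rewrite y10 // y20 // scaler0 addr0.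
    rewrite big_split /= -scaler_sumr.
    congr (_ *: _ + _); apply: widen; rewrite ?undup_uniq // => i i_s;
      by rewrite mem_undup mem_cat i_s ?orbT.
  have [i Vz] := SV z Sz; exists [:: i], (fun k => if k == i then z else 0).
  split=> // [k|k|].
  - case: eqP => [->|_]; first exact: mem_lspan.
    exact: (proj1 (sT k)).
  - by rewrite inE => /negPf->.
  - by rewrite big_seq1 eqxx.
pose z i := y i - (if i == m then x else 0).
have Vz i : V i (z i).
  rewrite /z -scaleN1r addrC; apply: (proj2 (sV i)); last exact: TV.
  by case: eqP => [->//|_]; apply: (proj1 (sV i)).
have uz := undup_uniq (m :: s); have zsum : \sum_(i <- undup (m :: s)) z i = 0.
  rewrite sumrB -(widen s _ y) // => [|i i_s]; last by rewrite mem_undup inE i_s orbT.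
  rewrite -ex -(widen [:: m]) ?big_seq1 ?eqxx ?subrr // => i.
    by rewrite mem_undup !inE => ->.
  by rewrite inE => /negPf->.
have := freeV _ z uz Vz zsum m; rewrite mem_undup mem_head /z eqxx => /(_ isT)/eqP.
by rewrite subr_eq0 => /eqP <-; apply: Ty.
Qed.

End DirectSum.

Lemma wtE n (ds : seq 'X_{1..n}) e : size e = size ds ->
  wt ds e = (\big[+%MM/0%MM]_(k < size ds) (nth 0%MM ds k *+ nth 0%N e k)%MM).
Proof.
elim: ds e => [|d ds IH] [|x e] //=; first by rewrite big_ord0.
by move=> [se]; rewrite big_ord_recl /= IH.
Qed.

Lemma wt_incr n (ds : seq 'X_{1..n}) e i : size e = size ds -> (i < size ds)%N ->
  wt ds (incr_nth e i) = (nth 0%MM ds i + wt ds e)%MM.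
Proof.
elim: ds e i => [|d ds IH] [|x e] [|i] //= [se] lt_i.
  by rewrite mulmS addmA.
by rewrite IH // !addmA (addmC (d *+ x)%MM).
Qed.

Section HilbertFunction.
Variables (K : fieldType) (charK : 2%N \notin [pchar K]).
Variables (A : superalgebra K) (bicA : bicommutative A).
Local Notation "x ** y" := (smul A x y) (at level 40, left associativity).
Variables (n : nat) (V : 'X_{1..n} -> A -> Prop).
Hypothesis gradV : graded_by (fun m1 m2 => (m1 + m2)%MM) V.
Variables (r : nat) (a : 'I_r -> A) (odda : 'I_r -> bool) (deg : 'I_r -> 'X_{1..n}).
Hypothesis a_odd : forall i, part (odda i) (a i).
Hypothesis a_deg : forall i, V (deg i) (a i).
Hypothesis a_gen : generates a.
Implicit Types (m : 'X_{1..n}) (e : seq nat).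

Local Notation monomial := (monomial a).
Local Notation two_sided := (two_sided r).

Let dirV : direct_sum_decomposition V. Proof. by case: gradV. Qed.
Let sV m : subspace (V m) := component_subspace dirV m.
Let VM m1 m2 x y : V m1 x -> V m2 y -> V (m1 + m2)%MM (x ** y).
Proof. by case: gradV => _ _; apply. Qed.

(** Every generator is a left letter and a right letter. *)
Definition weights : seq 'X_{1..n} := map deg (enum 'I_r) ++ map deg (enum 'I_r).
Definition odd_flags : seq bool := map odda (enum 'I_r) ++ map odda (enum 'I_r).

Lemma size_weights : size weights = (r + r)%N.
Proof. by rewrite size_cat size_map size_enum_ord. Qed.

Lemma size_odd_flags : size odd_flags = (r + r)%N.
Proof. by rewrite size_cat size_map size_enum_ord. Qed.

Lemma nth_weightsl (i : 'I_r) : nth 0%MM weights i = deg i.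
Proof.
rewrite nth_cat size_map size_enum_ord ltn_ord (nth_map i) ?size_enum_ord //.
by rewrite nth_ord_enum.
Qed.

Lemma nth_weightsr (i : 'I_r) : nth 0%MM weights (r + i) = deg i.
Proof.
rewrite nth_cat size_map size_enum_ord ltnNge leq_addr /= addKn.
by rewrite (nth_map i) ?size_enum_ord // nth_ord_enum.
Qed.

Lemma nth_odd_flagsl (i : 'I_r) : nth false odd_flags i = odda i.
Proof.
rewrite nth_cat size_map size_enum_ord ltn_ord (nth_map i) ?size_enum_ord //.
by rewrite nth_ord_enum.
Qed.

Lemma nth_odd_flagsr (i : 'I_r) : nth false odd_flags (r + i) = odda i.
Proof.
rewrite nth_cat size_map size_enum_ord ltnNge leq_addr /= addKn.
by rewrite (nth_map i) ?size_enum_ord // nth_ord_enum.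
Qed.

Lemma ltn_double_ord k : (k < r + r)%N ->
  (exists i : 'I_r, k = i) \/ (exists i : 'I_r, k = (r + i)%N).
Proof.
move=> lt_k; have [kr|rk] := ltnP k r; first by left; exists (Ordinal kr).
have kr : (k - r < r)%N by lia.
by right; exists (Ordinal kr); rewrite /= subnKC.
Qed.

Lemma wt_weights e : size e = (r + r)%N -> wt weights e =
  (\big[+%MM/0%MM]_(i < r) (deg i *+ nth 0%N e i) +
   \big[+%MM/0%MM]_(i < r) (deg i *+ nth 0%N e (r + i)))%MM.
Proof.
move=> se; rewrite wtE size_weights // big_split_ord /=.
by congr (_ + _)%MM; apply: eq_bigr => i _; rewrite ?nth_weightsl ?nth_weightsr.
Qed.

Lemma sum_letters f :
  (\big[+%MM/0%MM]_(i <- letters f) deg i = \big[+%MM/0%MM]_(i < r) (deg i *+ f i))%MM.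
Proof.
rewrite big_flatten big_map /= big_enum /=; apply: eq_bigr => i _.
by rewrite big_nseq; elim: (f i) => [|k IH] //; rewrite iterS IH mulmS.
Qed.

Lemma word_deg ls rs : ls != [::] ->
  V (\big[+%MM/0%MM]_(i <- ls) deg i + \big[+%MM/0%MM]_(i <- rs) deg i)%MM (word a ls rs).
Proof.
elim: ls => // i [|k ls] IH _.
  rewrite big_seq1 /=; elim: rs {IH} => [|j rs IH'] /=; first by rewrite big_nil addm0.
  by rewrite big_cons (addmC (deg j)) addmA; apply: VM.
by rewrite word_cons // big_cons -addmA; apply: VM; last exact: IH.
Qed.

Lemma monomial_deg e : size e = (r + r)%N -> two_sided e -> V (wt weights e) (monomial e).
Proof. by move=> se [l0 _]; rewrite wt_weights // -!sum_letters; apply: word_deg. Qed.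

Lemma component_span m x : V m x -> lspan (fun y => (exists2 i, deg i = m & y = a i) \/
  (exists e, [/\ size e = (r + r)%N, two_sided e, wt weights e = m & y = monomial e])) x.
Proof.
set T := lspan _; have sT : subspace T := lspan_subspace _.
move=> Vx; have Sx := span_generators_words bicA a_odd a_gen x.
have hom y : (exists i, y = a i) \/ is_word a y -> exists m', V m' y.
  case=> [[i ->]|yw]; first by exists (deg i).
  have [e [se te ey]] := is_word_monomial bicA a_odd yw; exists (wt weights e).
  exact: eq_sign_subspace (sV _) ey (monomial_deg se te).
have := lspan_component dirV hom Sx Vx; apply: lspan_min => // y [[[i ->]|yw] Vy].
  have [e|ne] := eqVneq (deg i) m; first by apply: mem_lspan; left; exists i.
  by rewrite (component_disjoint dirV ne (a_deg i) Vy); apply: (proj1 sT).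
have [e [se te ey]] := is_word_monomial bicA a_odd yw.
apply: (eq_sign_subspace sT ey).
have [em|ne] := eqVneq (wt weights e) m; first by apply: mem_lspan; right; exists e.
have Vm : V m (monomial e) by apply: eq_sign_subspace (sV m) (eq_sign_sym ey) Vy.
by rewrite (component_disjoint dirV ne (monomial_deg se te) Vm); apply: (proj1 sT).
Qed.

(** In a nonzero word each odd letter occurs at most once on the left and at
    most once on the right, and even letters do not contribute to the degree [j]. *)
Lemma component_bound (j : 'I_n) m x :
  (forall i, ~~ odda i -> deg i j = 0%N) -> (2 * \sum_(i < r) deg i j < m j)%N ->
  V m x -> x = 0.
Proof.
move=> even0 lt_m /component_span; move: x; apply: lspan_min.
  by split=> // c x y -> ->; rewrite scaler0 addr0.
move=> y [[i di _]|[e [se te em ->]]].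
  by move: lt_m; rewrite -di (bigD1 i) //=; lia.
have [/existsP[i /orP[/andP[oi ei]|/andP[oi ei]]]|] :=
  boolP [exists i, odda i && (1 < nth 0 e i)%N || odda i && (1 < nth 0 e (r + i))%N].
- exact: monomial_odd_left ei.
- exact: monomial_odd_right ei.
rewrite negb_exists => /forallP small; exfalso; move: lt_m.
rewrite -em wt_weights // mnmDE !mnm_sumE ltnNge mul2n -addnn leq_add //;
  apply: leq_sum => i _; rewrite mulmnE;
  have := small i; have := even0 i; case: (odda i) => /= [_|-> //]; rewrite negb_or -!leqNgt.
  by case/andP=> e1 _; rewrite -[leqRHS]muln1 leq_mul2l e1 orbT.
by case/andP=> _ e1; rewrite -[leqRHS]muln1 leq_mul2l e1 orbT.
Qed.

Hypothesis deg_neq0 : forall i, deg i <> 0%MM.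

Lemma weights_neq0 d : d \in weights -> d <> 0%MM.
Proof. by rewrite mem_cat => /orP[] /mapP[i _ ->]; apply: deg_neq0. Qed.

Definition smaller_monomial e x := exists e',
  [/\ size e' = (r + r)%N, two_sided e', wt weights e' = wt weights e, lexlt e' e
    & x = monomial e'].

(** These play the role of the leading monomials of a Groebner basis. *)
Definition reducible e := two_sided e /\ lspan (smaller_monomial e) (monomial e).

Definition standard : pred (seq nat) :=
  fun e => classically_true (two_sided e /\ ~ reducible e).

Lemma two_sided_incr e k : (k < r + r)%N -> two_sided e -> two_sided (incr_nth e k).
Proof.
by case/ltn_double_ord => -[i ->] te; [apply: two_sided_incrl | apply: two_sided_incrr].
Qed.

(** Multiplication by a letter is compatible with the order on the monomials. *)
Lemma reducible_incr e k : size e = (r + r)%N -> (k < r + r)%N ->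
  reducible e -> reducible (incr_nth e k).
Proof.
move=> se lt_k [te le]; split; first exact: two_sided_incr.
have [T [sT TE]] : exists T : A -> A, (forall P, subspace P -> subspace (fun y => P (T y))) /\
    forall e', two_sided e' -> eq_sign (monomial (incr_nth e' k)) (T (monomial e')).
  case/ltn_double_ord: lt_k => -[i ->].
    exists (fun y => a i ** y); split=> [P|e' te']; first exact: subspace_mull.
    exact: (monomial_incrl bicA a_odd).
  exists (fun y => y ** a i); split=> [P|e' te']; first exact: subspace_mulr.
  exact: (monomial_incrr bicA a_odd).
have sS : subspace (lspan (smaller_monomial (incr_nth e k))) := lspan_subspace _.
apply: (eq_sign_subspace sS (TE e te)); move: le.
apply: (lspan_min (sT _ sS)) => _ [e' [se' te' we' lt_e ->]].
apply: (eq_sign_subspace sS (eq_sign_sym (TE e' te'))); apply: mem_lspan.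
exists (incr_nth e' k); split=> //.
- by rewrite size_incr_nth se' lt_k.
- exact: two_sided_incr.
- by rewrite !wt_incr ?size_weights // we'.
- by apply: lexlt_incr; rewrite ?se ?se'.
Qed.

(** Listing the generators before the words, and the words in decreasing order, makes
    the entries after a word exactly the smaller words of the same degree. *)
Definition generator_list m := [seq a i | i <- enum 'I_r & deg i == m].
Definition exponent_list m :=
  rev [seq e <- fiber weights m | classically_true (two_sided e)].

Lemma mem_exponent_list m e : e \in exponent_list m <->
  [/\ size e = (r + r)%N, wt weights e = m & two_sided e].
Proof.
rewrite mem_rev mem_filter fiberP; last exact: weights_neq0.
rewrite size_weights; split=> [/and3P[/classically_trueP te /eqP se /eqP we] //|[se we te]].
by rewrite se we !eqxx !andbT; apply/classically_trueP.
Qed.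

Definition hilb m := rank (generator_list m ++ map monomial (exponent_list m)).

Lemma hilbP : hilbert_function V hilb.
Proof.
move=> m; apply: has_dim_ext (has_dim_span _) => x; split=> [|Vx].
  move: x; apply: lspan_min => // x; rewrite mem_cat => /orP[/mapP[i]|/mapP[e]].
    by rewrite mem_filter => /andP[/eqP <- _] ->.
  by move=> /mem_exponent_list[se <- te] ->; apply: monomial_deg.
apply: sub_lspan (component_span Vx) => y [[i di ->]|[e [se te we ->]]].
  by rewrite mem_cat map_f // mem_filter di eqxx mem_enum.
by rewrite mem_cat (map_f monomial) ?orbT //; apply/mem_exponent_list.
Qed.

Lemma rank_exponent_list m :
  rank (map monomial (exponent_list m)) = count standard (fiber weights m).
Proof.
rewrite (@rank_map _ _ _ _ standard) => [|l1 e l2 el].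
  rewrite count_rev count_filter; apply: eq_in_count => e _ /=.
  apply/andP/idP => [[]//|se]; split=> //.
  by apply/classically_trueP; case/classically_trueP: se.
have e_in : e \in exponent_list m by rewrite el mem_cat mem_head orbT.
have [se we te] := (mem_exponent_list m e).1 e_in.
have sortE : pairwise lexlt (rev (exponent_list m)).
  by rewrite revK; apply/pairwise_filter/fiber_sorted/weights_neq0.
have below e' : e' \in l2 <-> e' \in exponent_list m /\ lexlt e' e.
  move: sortE; rewrite el rev_cat rev_cons cat_rcons pairwise_cat => /and3P[/allrelP h1 _].
  rewrite pairwise_cons => /andP[/allP h2 _]; split=> [e'2|[]].
    split; first by rewrite mem_cat inE e'2 !orbT.
    by apply: h1; rewrite ?mem_rev ?mem_head.
  rewrite mem_cat inE => /or3P[e'1|/eqP->|//] lt_e; last by rewrite lexlt_irr in lt_e.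
  by case: (@lexlt_asym e e') => //; apply: h2; rewrite mem_rev.
have spanE : in_span (map monomial l2) (monomial e) <-> lspan (smaller_monomial e) (monomial e).
  split; apply: sub_lspan => y.
    case/mapP => e' /below[/mem_exponent_list[se' we' te'] lt_e ->].
    by exists e'; split; rewrite // we'.
  case=> e' [se' te' we' lt_e ->]; apply: map_f; apply/below; split=> //.
  by apply/mem_exponent_list; rewrite we' we.
split=> [/classically_trueP[_ nr] /spanE h|ns]; first by apply: nr.
by apply/classically_trueP; split=> // -[_ /spanE].
Qed.

Lemma standard_bounded e k : size e = (r + r)%N ->
  standard e -> nth false odd_flags k -> (nth 0 e k < 2)%N.
Proof.
move=> se /classically_trueP[te nre] ok.
have lt_k : (k < r + r)%N.
  by rewrite -size_odd_flags ltnNge; apply: contraTN ok => /(nth_default _)->.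
rewrite ltnNge; apply/negP => ek; apply: nre; split=> //.
suff -> : monomial e = 0 by apply: (proj1 (lspan_subspace _)).
case/ltn_double_ord: lt_k ok ek => -[i ->]; rewrite ?nth_odd_flagsl ?nth_odd_flagsr => oi ei.
  by apply: (monomial_odd_left bicA a_odd charK te oi); lia.
by apply: (monomial_odd_right bicA a_odd charK te oi); lia.
Qed.

Definition even_weights := mask (map negb odd_flags) weights.

Lemma even_weightsP d : d \in even_weights -> exists2 i, ~~ odda i & d = deg i.
Proof.
rewrite /even_weights /odd_flags map_cat mask_cat ?size_map // -map_comp -map_mask.
rewrite -filter_mask mem_cat orbb => /mapP[i].
by rewrite mem_filter => /andP[oi _] ->; exists i.
Qed.

(** The dimension exceeds the number of standard monomials only in the degrees of
    the generators. *)
Theorem hilb_rational : finsupp (clear even_weights (fun m => (hilb m)%:R)).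
Proof.
(* c m counts the generators of degree m needed beyond the span of the words *)
pose c m : int := (hilb m)%:R - cnt weights standard m.
have -> : (fun m => (hilb m)%:R) = (fun m => c m + cnt weights standard m).
  by apply: functional_extensionality => m; rewrite subrK.
rewrite clearD; apply: finsuppD.
  apply: finsupp_clear; exists (\sum_(i < r) mdeg (deg i)).+1 => m lt_m.
  have -> : c m = 0 => //; rewrite /c /cnt -rank_exponent_list /hilb /generator_list.
  rewrite (@eq_in_filter _ _ pred0) ?filter_pred0 ?subrr // => i _.
  by apply/eqP => e; move: lt_m; rewrite -e (bigD1 i) //=; lia.
apply: (@finsupp_cnt _ _ _ two_sided reducible); rewrite ?size_odd_flags ?size_weights //.
- exact: weights_neq0.
- by move=> e k _; apply: two_sided_incr.
- exact: reducible_incr.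
- by move=> e _; split=> [/classically_trueP//|h]; apply/classically_trueP.
- exact: standard_bounded.
Qed.

End HilbertFunction.

(** * Reduction to homogeneous generators *)

Section SingleGrading.
Variables (K : fieldType) (A : superalgebra K) (V : nat -> A -> Prop).
Hypothesis posV : positively_graded V.

Definition homogeneous_list (L : seq (A * nat * bool)) :=
  forall t, t \in L -> [/\ V t.1.2 t.1.1, part t.2 t.1.1 & (0 < t.1.2)%N].

Definition spanned_by (L : seq (A * nat * bool)) :=
  lspan (fun y => exists2 t, t \in L & y = t.1.1).

Lemma spanned_by_sub (L L' : seq (A * nat * bool)) x :
  {subset L <= L'} -> spanned_by L x -> spanned_by L' x.
Proof. by move=> LL'; apply: sub_lspan => y [t /LL' tL' ->]; exists t. Qed.

(** The homogeneous components of [x], each split into its even and odd part. *)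
Lemma homogeneous_span x : exists L, homogeneous_list L /\ spanned_by L x.
Proof.
case: posV => -[[_ genV _] superV _] V0.
have [s [y [Vy ->]]] := genV x; elim: s => [|i s [L [hL sL]]].
  by exists [::]; split=> //; rewrite big_nil; apply: (proj1 (lspan_subspace _)).
rewrite big_cons; have [i0|i_gt0] := posnP i.
  by rewrite i0 (V0 (y 0%N)) // add0r; exists L.
have [x0 [x1 [p0 p1 V0' V1' ->]]] := proj2 (superV i) _ (Vy i).
exists [:: (x0, i, false), (x1, i, true) & L]; split.
  by move=> t; rewrite !inE => /or3P[/eqP->|/eqP->|/hL].
have sN := lspan_subspace (fun z : A => exists2 t,
  t \in [:: (x0, i, false), (x1, i, true) & L] & z = t.1.1).
apply: (subspaceD sN); last first.
  by apply: spanned_by_sub sL => t tL; rewrite !inE tL !orbT.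
apply: (subspaceD sN); apply: mem_lspan.
  by exists (x0, i, false); rewrite ?inE ?eqxx.
by exists (x1, i, true); rewrite ?inE ?eqxx ?orbT.
Qed.

Lemma homogeneous_generators : finitely_generated A ->
  exists (r : nat) (a : 'I_r -> A) (d : 'I_r -> nat) (b : 'I_r -> bool),
    generates a /\ forall i, [/\ V (d i) (a i), part (b i) (a i) & (0 < d i)%N].
Proof.
move=> [r [a gen_a]].
have /fin_all_exists[L hL] (i : 'I_r) : exists L, homogeneous_list L /\ spanned_by L (a i).
  exact: homogeneous_span.
pose M := flatten [seq L i | i <- enum 'I_r].
have subM i : {subset L i <= M}.
  by move=> t t_L; apply/flatten_mapP; exists i; rewrite ?mem_enum.
have hM : homogeneous_list M by move=> t /flatten_mapP[i _ /(proj1 (hL i))].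
pose t0 : A * nat * bool := (0, 0%N, false).
exists (size M), (fun i => (nth t0 M i).1.1), (fun i => (nth t0 M i).1.2),
  (fun i => (nth t0 M i).2).
split=> [B sB BM Ba|i]; last by apply: hM; apply: mem_nth.
apply: gen_a => // i; have := spanned_by_sub (@subM i) (proj2 (hL i)).
apply: (lspan_min sB) => _ [t tM ->].
have lt_t : (index t M < size M)%N by rewrite index_mem.
by have := Ba (Ordinal lt_t); rewrite /= nth_index.
Qed.

Lemma graded_by_mon1 :
  graded_by (fun m1 m2 => (m1 + m2)%MM) (fun m : 'X_{1..1} => V (m ord0)).
Proof.
case: posV => -[[sV genV freeV] superV VM] _.
split=> [|m|m1 m2 x y Vx Vy]; last by rewrite mnmDE; apply: VM.
  split=> [m|x|s y us Vy sum0 m m_s]; first exact: sV.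
    have [s [y [Vy ->]]] := genV x; exists (map mon1 s), (fun m : 'X_{1..1} => y (m ord0)).
    by split=> [m|] //; rewrite big_map; apply: eq_bigr => i _; rewrite mon1E.
  rewrite -(mon1K m).
  apply: (freeV [seq (m' : 'X_{1..1}) ord0 | m' <- s] (fun i => y (mon1 i))).
  - by rewrite map_inj_uniq // => m1 m2 e; rewrite -(mon1K m1) e mon1K.
  - by move=> i; have := Vy (mon1 i); rewrite mon1E.
  - by rewrite big_map -[RHS]sum0; apply: eq_bigr => m' _; rewrite mon1K.
  - by apply: map_f.
exact: superV.
Qed.

End SingleGrading.

Lemma multigraded_parity (K : fieldType) (A : superalgebra K) (p q : nat)
    (V : 'X_{1..p + q} -> A -> Prop) (r : nat) (a : 'I_r -> A) (deg : 'I_r -> 'X_{1..p + q}) :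
  multigraded_generators V a deg ->
  exists odda : 'I_r -> bool,
    [/\ forall i, part (odda i) (a i), forall i, deg i <> 0%MM
      & forall i j, ~~ odda i -> deg i (rshift p j) = 0%N].
Proof.
move=> [_ gen_a].
have /fin_all_exists[odda oddaP] (i : 'I_r) : exists b : bool,
    [/\ part b (a i), deg i <> 0%MM & forall j, ~~ b -> deg i (rshift p j) = 0%N].
  have [_ [[pa [[k dk] dj]]|[pa [j dj]]]] := gen_a i.
    by exists false; split=> // d0; apply: dk; rewrite d0 mnm0E.
  by exists true; split=> // d0; apply: dj; rewrite d0 mnm0E.
by exists odda; split=> i *; case: (oddaP i) => // _ _; apply.
Qed.

Definition even_part (p q : nat) (d : 'X_{1..p + q}) : 'X_{1..p} :=
  [multinom d (lshift q k) | k < p].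

Lemma umonom_even_part p q (d : 'X_{1..p + q}) :
  (forall j, d (rshift p j) = 0%N) -> umonom q (even_part d) = d.
Proof.
move=> d0; apply/mnmP => i; rewrite mnmE; case: splitP => [k|j] ik.
  by rewrite mnmE; congr (d _); apply: val_inj.
by rewrite -(d0 j); congr (d _); apply: val_inj.
Qed.

Theorem theorem4p5 (K : fieldType) (charK : 2%N \notin [pchar K]) :
  (forall (A : superalgebra K) (V : nat -> A -> Prop),
     bicommutative A -> finitely_generated A -> positively_graded V ->
     exists H : nat -> nat,
       hilbert_function V H /\
       exists (f : {poly int}) (ds : seq nat),
         (forall d, d \in ds -> (0 < d)%N) /\
         forall n : nat,
           (H n)%:R = series_mul (fun i => f`_i) (series_inv_prod ds) n)
  /\
  (forall (p q : nat) (A : superalgebra K) (V : 'X_{1..p + q} -> A -> Prop),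
     bicommutative A -> multigraded V ->
     (exists (r : nat) (a : 'I_r -> A) (deg : 'I_r -> 'X_{1..p + q}),
        multigraded_generators V a deg) ->
     exists H : 'X_{1..p + q} -> nat,
       hilbert_function V H /\
       exists (f : {mpoly int[p + q]}) (ds : seq 'X_{1..p}),
         [/\ forall d, d \in ds -> d <> 0%MM,
             forall m : 'X_{1..p + q},
               (H m)%:R =
               mseries_mul (fun k => f@_k)
                 (mseries_inv_prod [seq umonom q d | d <- ds]) m
           & forall (r : nat) (a : 'I_r -> A) (deg : 'I_r -> 'X_{1..p + q}),
               multigraded_generators V a deg ->
               forall j : 'I_q,
                 (degree_in (rshift p j) f
                    <= 2 * \sum_(i < r) deg i (rshift p j))%N]).
Proof.
split.
- move=> A V bicA fgA posV.
  have [r [a [d [b [gen_a ha]]]]] := homogeneous_generators posV fgA.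
  pose W (m : 'X_{1..1}) := V (m ord0); pose deg i := mon1 (d i).
  have gradW : graded_by (fun m1 m2 => (m1 + m2)%MM) W := graded_by_mon1 posV.
  have a_odd i : part (b i) (a i) by case: (ha i).
  have a_deg i : W (deg i) (a i) by rewrite /W mon1E; case: (ha i).
  have deg0 i : deg i <> 0%MM.
    by move=> /(congr1 (fun m : 'X_{1..1} => m ord0)); rewrite mon1E mnm0E; case: (ha i); lia.
  pose h := hilb a deg; pose L := even_weights b deg.
  have hP : hilbert_function W h by apply: (hilbP bicA gradW a_odd a_deg gen_a deg0).
  have [N LN] : finsupp (clear L (fun m => (h m)%:R)).
    exact: (hilb_rational charK bicA a_odd deg0).
  have L0 m : m \in L -> m <> 0%MM by case/even_weightsP => i _ ->.
  exists (fun n => h (mon1 n)); split=> [n|]; first by have := hP (mon1 n); rewrite /W mon1E.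
  exists (\poly_(i < N) clear L (fun m => (h m)%:R) (mon1 i)),
    [seq (m : 'X_{1..1}) ord0 | m <- L].
  split=> [_ /mapP[m mL ->]|n].
    rewrite lt0n; apply/eqP => m0; apply: (L0 m mL).
    by rewrite -(mon1K m) m0; apply/mnmP => k; rewrite !mnmE.
  have -> : (fun i => (\poly_(i < N) clear L (fun m => (h m)%:R) (mon1 i))`_i) =
      (fun i => clear L (fun m => (h m)%:R) (mon1 i)).
    apply: functional_extensionality => i; rewrite coef_poly; case: ltnP => // Ni.
    by rewrite LN // mdeg_mon1.
  rewrite series_inv_prod_mon1 -map_comp map_id_in => [|m _]; last exact: mon1K.
  rewrite series_mul_mon1 -mseries_clear //.
- move=> p q A V bicA gradV [r [a [deg gen]]].
  have [odda [a_odd deg0 even0]] := multigraded_parity gen.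
  have [gen_a a_degP] := gen; have a_deg i : V (deg i) (a i) by case: (a_degP i).
  pose h := hilb a deg; pose L := even_weights odda deg.
  have hP : hilbert_function V h by apply: (hilbP bicA gradV a_odd a_deg gen_a deg0).
  have [f fE] : exists f : {mpoly int[p + q]}, forall m, f@_m = clear L (fun m => (h m)%:R) m.
    by apply: finsupp_poly; apply: (hilb_rational charK bicA a_odd deg0).
  have L0 m : m \in L -> m <> 0%MM by case/even_weightsP => i _ ->.
  have Lv m j : m \in L -> m (rshift p j) = 0%N by case/even_weightsP => i oi ->; apply: even0.
  have LE : [seq umonom q d | d <- [seq even_part d | d <- L]] = L.
    by rewrite -map_comp map_id_in // => m mL /=; apply: umonom_even_part => j; apply: Lv.
  exists h; split=> //; exists f, [seq even_part d | d <- L]; split.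
  + move=> _ /mapP[m mL ->] m0; apply: (L0 m mL).
    rewrite -(umonom_even_part (fun j => Lv m j mL)) m0; apply/mnmP => i.
    by rewrite mnmE mnm0E; case: split => // k; rewrite mnm0E.
  + move=> m; rewrite LE (functional_extensionality _ _ fE).
    by rewrite -mseries_clear.
  + move=> r' a' deg' gen' j.
    have [odda' [a'_odd deg'0 even'0]] := multigraded_parity gen'.
    have [gen_a' a'_degP] := gen'; have a'_deg i : V (deg' i) (a' i) by case: (a'_degP i).
    (* clearing denominators in the even variables does not raise the degree in v_j,
       so it suffices to bound the degree of the Hilbert series itself, and for this
       every generating set may be used, not only the one that gave f *)
    apply/bigmax_leqP_seq => m; rewrite mcoeff_msupp fE => + _; apply: contraR.
    rewrite -ltnNge => lt_m; apply/eqP; move: m lt_m.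
    apply: clear_support => [m mL|m lt_m]; first exact: Lv.
    rewrite (has_dim_trivial (hP m)) // => x.
    by apply: (component_bound charK bicA gradV a'_odd a'_deg gen_a' _ lt_m) => i; apply: even'0.
Qed.
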